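(* Let $(X,\nu)$ be a Lebesgue probability space on which the free group $F_m$ acts by measure-preserving transformations, and let $p>1$. Let $\Pi=(p_{ij})_{i,j\in\mathcal A}$ be a stochastic matrix having a unique stationary distribution $(p_i)_{i\in\mathcal A}$, with $p_i>0$ for all $i\in\mathcal A$. Assume that $\Pi$ is strictly irreducible and that for all $i,j\in\mathcal A$ $$p_i=p_{-i},\qquad p_{-i,-j}=\frac{p_jp_{ji}}{p_i}.$$ Then for any $\varphi\in L_p(X,\nu)$ the sequence $s_{2n}^{\Pi}\varphi$ converges as $n\to\infty$, both $\nu$-almost everywhere and in $L_p$, to an $F_m^2$-invariant function.
   Context: $F_m$ is the free group with free generators $a_1,\dots,a_m$; $T_g$ ($g\in F_m$) denotes the measure-preserving transformation of $(X,\nu)$ given by $g$, $T_i$ is the transformation corresponding to $a_i$, and $T_{-i}=T_i^{-1}$ for $i=1,\dots,m$. $\mathcal A=\{-m,\dots,-1,1,\dots,m\}$; the rows and columns of the $2m\times 2m$ matrix $\Pi$ are indexed by $\mathcal A$. $F_m$ acts on functions by $T_g\varphi=\varphi\circ T_{g^{-1}}$. For a word $w=w_1\dots w_n$ over the alphabet $\mathcal A$ (all words, $|w|=n$ its length) put $T_w=T_{w_1}T_{w_2}\cdots T_{w_n}$, so that $T_w\varphi=\varphi\circ T_w^{-1}$ on functions, $p(w)=p_{w_nw_{n-1}}p_{w_{n-1}w_{n-2}}\cdots p_{w_2w_1}$ (equal to $1$ if $n=1$), and $\pi(w)=p_{w_n}p(w)$. Define $$s_n^{\Pi}=\sum_{|w|=n}\pi(w)T_w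 .$$ $F_m^2$ is the subgroup of words of even length in $F_m$, i.e. the subgroup generated by $a_ia_j$, $i,j\in\{1,\dots,m\}$. A square matrix $M$ with nonnegative entries is irreducible if for some $n>0$ all entries of $M+M^2+\dots+M^n$ are positive. $\Pi$ is strictly irreducible if $\Pi$ is irreducible and $\Pi\Pi^T$ is irreducible ($\Pi^T$ is the transpose). *)

(* Defs.v *)
From HB Require Import structures.
From mathcomp Require Import all_boot all_order all_algebra.
From mathcomp Require Import all_classical all_reals all_analysis.

Set Implicit Arguments.
Unset Strict Implicit.
Unset Printing Implicit Defensive.

Import Order.TTheory GRing.Theory Num.Theory.
Import numFieldNormedType.Exports.

Local Open Scope classical_set_scope.
Local Open Scope ring_scope.

(* The alphabet {-m, .., -1, 1, .., m}: lshift m i stands for the (i+1)-st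
   positive letter and rshift m i for its negative. *)
Notation letter m := 'I_(m + m).

Definition linv (m : nat) (a : letter m) : letter m :=
  match fintype.split a with
  | inl i => rshift m i
  | inr i => lshift m i
  end.

Lemma linvK (m : nat) : involutive (@linv m).
Proof.
move=> a; rewrite /linv; case: (fintype.splitP a) => i ai.
  by rewrite -[rshift m i]/(unsplit (inr i)) unsplitK; exact/val_inj.
by rewrite -[lshift m i]/(unsplit (inl i)) unsplitK; exact/val_inj.
Qed.

Definition reduced (m : nat) (w : seq (letter m)) : bool :=
  sorted (fun a b => b != linv a) w.

Record free_group (m : nat) := FreeGroup {
  fg_word :> seq (letter m);
  fg_reduced : reduced fg_word
}.

HB.instance Definition _ (m : nat) := [isSub for @fg_word m].
HB.instance Definition _ (m : nat) := [Choice of free_group m by <:].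

Section FreeGroup.
Variable m : nat.
Implicit Types (a b : letter m) (u v w : seq (letter m)) (g h k : free_group m).

Definition push a w :=
  if w is b :: w' then if b == linv a then w' else a :: w else [:: a].

Lemma reduced_push a w : reduced w -> reduced (push a w).
Proof.
case: w => //= b w rw; case: eqP => [_|/eqP ba].
  exact: path_sorted rw.
by rewrite /reduced /= ba.
Qed.

Lemma pushK a w : reduced w -> push (linv a) (push a w) = w.
Proof.
case: w => [|b w] /= rw; first by rewrite linvK eqxx.
case: eqP rw => [->|_] rw /=; last by rewrite linvK eqxx.
by case: w rw => [|c w] //= /andP[/negPf ->].
Qed.

Lemma reduced_foldr u v : reduced v -> reduced (foldr push v u).
Proof. by move=> rv; elim: u => //= a u IHu; exact: reduced_push. Qed.

Lemma foldr_push a u v : reduced v -> reduced u ->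
  foldr push v (push a u) = push a (foldr push v u).
Proof.
move=> rv; case: u => [//|b u] /= ru; case: eqP => [->|//].
by have := pushK (linv a) (reduced_foldr u rv); rewrite linvK => ->.
Qed.

Definition fg_mul g h : free_group m :=
  FreeGroup (reduced_foldr g (fg_reduced h)).

Definition fg_one : free_group m := @FreeGroup m [::] isT.

Lemma reduced_inv u : reduced u -> reduced (rev (map (@linv m) u)).
Proof.
rewrite /reduced rev_sorted sorted_map; apply: sub_sorted => a b /= ba.
by rewrite linvK; apply: contra ba => /eqP ->.
Qed.

Definition fg_inv g : free_group m := FreeGroup (reduced_inv (fg_reduced g)).

Lemma fg_mulA : associative fg_mul.
Proof.
move=> g h k; apply: val_inj => /=.
elim: (fg_word g) => //= a u ->; rewrite foldr_push //; first exact: fg_reduced.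
by apply: reduced_foldr; exact: fg_reduced.
Qed.

Lemma fg_mul1 : left_id fg_one fg_mul.
Proof. by move=> g; exact: val_inj. Qed.

Lemma fg_mulr1 : right_id fg_one fg_mul.
Proof.
case=> u ru; apply: val_inj => /=; elim: u ru => //= a u IHu ru.
rewrite IHu; last exact: path_sorted ru.
by case: u ru {IHu} => //= b u /andP[/negPf ->].
Qed.

Lemma fg_mulV : left_inverse fg_one fg_inv fg_mul.
Proof.
case=> u ru; apply: val_inj => /=; elim: u ru => //= a u IHu ru.
rewrite rev_cons foldr_rcons /= linvK eqxx IHu //.
exact: path_sorted ru.
Qed.

Lemma fg_invK : involutive fg_inv.
Proof. by move=> g; apply: val_inj; rewrite /= map_rev revK mapK //; exact: linvK. Qed.

Lemma fg_mulrV : right_inverse fg_one fg_inv fg_mul.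
Proof. by move=> g; rewrite -{1}(fg_invK g) fg_mulV. Qed.

HB.instance Definition _ := isGroup.Build (free_group m)
  fg_mulA fg_mul1 fg_mulr1 fg_mulV fg_mulrV.

Definition fg_letter a : free_group m := @FreeGroup m [:: a] isT.

Lemma fg_letterV a : ((fg_letter a)^-1)%g = fg_letter (linv a).
Proof. exact: val_inj. Qed.

End FreeGroup.

(* The subgroup F_m^2 generated by the products of two generators: reduction
   preserves the parity of the length of a word. *)
Definition even_fg (m : nat) : {pred free_group m} :=
  [pred g : free_group m | ~~ odd (size (fg_word g))].

Section StochasticMatrices.
Variables (R : realType) (n : nat).
Implicit Types (M : 'M[R]_n) (q : 'rV[R]_n).

Definition irreducible_mx M : Prop :=
  exists2 k : nat, (0 < k)%N &
    forall i j, 0 < (\sum_(1 <= l < k.+1) M ^+ l) i j.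

Definition strictly_irreducible_mx M : Prop :=
  irreducible_mx M /\ irreducible_mx (M *m M^T).

Definition stochastic_mx M : Prop :=
  (forall i j, 0 <= M i j) /\ (forall i, \sum_j M i j = 1).

Definition stationary_distribution M q : Prop :=
  [/\ forall i, 0 <= q 0 i, \sum_i q 0 i = 1 & q *m M = q].

End StochasticMatrices.

Section LebesgueSpaces.
Variable R : realType.

(* Lebesgue measure on [0, c] (null if c <= 0) together with atoms of weights w 0, w 1, ..
   placed at the points -1, -2, .. *)
Definition interval_with_atoms (c : R) (w : nat -> {nonneg R}) :
    {measure set (measurableTypeR R) -> \bar R} :=
  measure_add
    (mrestr lebesgue_measure (measurable_itv `[0, c]))
    (mseries (fun n => mscale (w n) \d_(- n.+1%:R : measurableTypeR R)) 0).

(* Isomorphism modulo null sets between a complete measure space and the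
   completion of (Y, mu): mu^* is the outer measure induced by mu, and for
   sigma-finite mu its Caratheodory measurable sets are the mu-completion of
   the measurable sets of Y. *)
Definition isomorphic_mod0 (d d' : measure_display) (X : measurableType d)
    (Y : measurableType d') (nu : {measure set X -> \bar R})
    (mu : {measure set Y -> \bar R}) : Prop :=
  exists (X0 : set X) (Y0 : set Y) (f : X -> Y),
    [/\ measurable X0 /\ nu (~` X0) = 0%E,
        measurable Y0 /\ mu (~` Y0) = 0%E,
        set_bij X0 Y0 f,
        forall A, A `<=` X0 ->
          (measurable A <-> (mu^*)%mu.-cara.-measurable (f @` A)) &
        forall A, A `<=` X0 -> measurable A -> nu A = (mu^*)%mu (f @` A)].

Definition lebesgue_probability_space (d : measure_display)
    (X : measurableType d) (nu : probability X R) : Prop :=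
  measure_is_complete nu /\
  exists (c : R) (w : nat -> {nonneg R}),
    isomorphic_mod0 nu (interval_with_atoms c w).

End LebesgueSpaces.

Record measure_preserving_action (R : realType) (d : measure_display)
    (X : measurableType d) (nu : probability X R) (G : groupType)
    (T : G -> X -> X) : Prop := {
  mpa_1 : forall x, T 1%g x = x;
  mpa_M : forall g h x, T (g * h)%g x = T g (T h x);
  mpa_measurable : forall g, measurable_fun setT (T g);
  mpa_preserving : forall g A, measurable A -> nu (T g @^-1` A) = nu A
}.

Definition koopman (X Y : Type) (G : groupType) (T : G -> X -> X) (g : G)
    (phi : X -> Y) : X -> Y :=
  phi \o T (g^-1)%g.

Section SphericalAverages.
Variables (R : realType) (m : nat) (X : Type) (T : free_group m -> X -> X).
Variables (Pi : 'M[R]_(m + m)) (q : 'rV[R]_(m + m)).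
Implicit Types w : seq (letter m).

Definition word_op w (phi : X -> R) : X -> R :=
  foldr (fun a psi => koopman T (fg_letter a) psi) phi w.

(* Words are read from right to left: the weight of w_1 .. w_n is
   Pi w_n w_{n-1} * .. * Pi w_2 w_1. *)
Fixpoint transition_weight w : R :=
  if w is a :: w' then
    (if w' is b :: _ then transition_weight w' * Pi b a else 1)
  else 1.

(* The value on the empty word is a convention. *)
Definition word_weight w : R :=
  if w is a :: w' then q 0 (last a w') * transition_weight w else 1.

Definition spherical_sum (n : nat) (phi : X -> R) : X -> R :=
  fun x => \sum_(w : n.-tuple (letter m)) word_weight w * word_op w phi x.

End SphericalAverages.

(* Main.v *)
Require Import Defs.
From HB Require Import structures.
From mathcomp Require Import all_boot all_order all_algebra.
From mathcomp Require Import all_classical all_reals all_analysis.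
From mathcomp Require Import measurable_realfun.
From mathcomp Require Import ring lra.
Import Order.TTheory GRing.Theory Num.Theory.
Import numFieldNormedType.Exports.
Local Open Scope classical_set_scope.
Local Open Scope ring_scope.

Set Implicit Arguments.
Unset Strict Implicit.
Unset Printing Implicit Defensive.

(** The spherical sums are matrix coefficients of a Markov operator. Write
    tau i for the action of the inverse of the i-th letter, and let P act on
    vectors f = (f_i) of functions indexed by the letters by
      (P f)_i x = \sum_j A i j * f_j (tau i x),
    where A is Pi with both letters inverted. Then, with Phi = (phi, .., phi),
    the sum of length 2k+2 is the q-average over the letters of P^(2k+1) (P Phi)
    ([spherical_sum_even_average]). The hypothesis on Pi says that the random
    walk on letters, reversed in time and with inverted letters, has the same
    law. In terms of operators, P = U L: L f = \sum_j A (-i) j * f_j turns at a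
    point without moving, is self-adjoint for the weights q, and the flip
    (U f)_i x = f_(-i) (tau i x) is a unitary involution. Hence P* = U P U.

    Mean convergence for bounded functions. The energies |P^k g|^2 decrease, so
    |P^k g|^2 - |L P^k g|^2 tends to 0; this defect is a sum of squared
    differences of coordinates over the support of L^2, which is that of
    Pi Pi^T. As Pi Pi^T is irreducible, the coordinates of P^k g become equal
    in the limit ([letter_diff_cvg0]), and so L P^k g - P^k g tends to 0.
    On the other hand P*^k P^k g is Cauchy, because
    |u - P*^k P^k u|^2 <= |u|^2 - |P^k u|^2, and U P*^(k+1) P^(k+1) g is
    P^(k+1) L P^k g, which is close to P^(2k+1) g. Thus P^(2k+1) g converges
    in L^2 ([bounded_orbit_limit]). Its limit w has equal coordinates, so does
    P w, and P (P w) = w; this is invariance under all products of two letters.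

    Maximal inequality. Fix g >= 0 and consider the space of pairs of a word
    and a point, on which the reversal of paths preserves the measure. Doob's
    inequality bounds in L^p the maximal function of g along the past; compose
    it repeatedly with reversals, which exchange past and future. The maximum
    along the past dominates P^a g somewhere in the middle of the path; the next
    one, along the future, dominates L P^a g there, and after n repetitions
    L^n P^a g is dominated, for all a at once. For a suitable odd n
    the matrix of L^n has a positive diagonal ([odd_power_diagonal]), so that
    L^n >= eps; it remains to move a+1 further steps to dominate P^(2a+1) g.
    This gives the weak (p, p) inequality, for every p > 1, for the supremum
    over a of the q-averages of P^(2a+1) g
    ([weak_maximal_ineq]).

    Almost everywhere convergence for bounded functions follows from the mean
    convergence and the maximal inequality with exponent 2, since
    P^(2l+1) g - w = P^(2j+1) (P (P^(2k+1) g - w)) for l = j + k + 1. For phi in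
    L^p one truncates phi: the maximal inequality with exponent p gives the
    convergence almost everywhere, and the contraction property of the averages
    in L^p gives the convergence in norm and the invariance of the limit
    ([even_average_converges]). *)

(** * Inequalities between powers *)
Section PowerInequalities.
Variables (R : realType) (p : R).
Hypothesis p_gt1 : 1 < p.

Let p_gt0 : 0 < p. Proof. exact: lt_trans p_gt1. Qed.
Let p1_gt0 : 0 < p - 1. Proof. by rewrite subr_gt0. Qed.
Let p1_neq0 : p - 1 != 0. Proof. by rewrite gt_eqF. Qed.

(** Young's inequality. In Doob's argument a running maximum jumps from a to b
    exactly when the martingale takes the value b; since the right-hand side is
    linear in that last factor b, the martingale can there be replaced by its
    final value. *)
Lemma powR_increment_le (a b : R) : 0 <= a -> a <= b ->
  b `^ p - a `^ p <= p / (p - 1) * ((b `^ (p - 1) - a `^ (p - 1)) * b).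
Proof.
move=> a0 ab; have b0 : 0 <= b by exact: le_trans ab.
have q0 : 0 < p / (p - 1) by rewrite divr_gt0.
have := @conjugate_powR _ b (a `^ (p - 1)) p (p / (p - 1)) b0 (powR_ge0 _ _) p_gt0 q0.
rewrite -powRrM [(p - 1) * _]mulrC divfK // invf_div.
have -> : p^-1 + (p - 1) / p = 1 by field; rewrite gt_eqF.
move=> /(_ erefl) young.
have bE : b `^ (p - 1) * b = b `^ p by rewrite mulrC mulr_powRB1.
rewrite mulrBl bE [_ * b]mulrC -subr_ge0.
have -> : p / (p - 1) * (b `^ p - b * a `^ (p - 1)) - (b `^ p - a `^ p) =
   p / (p - 1) * (b `^ p / p + a `^ p * ((p - 1) / p) - b * a `^ (p - 1)).
  by field; rewrite p1_neq0 gt_eqF.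
by rewrite mulr_ge0 ?subr_ge0 // ltW.
Qed.

(** The constant that comes from the case u < 2 * (p / (p - 1)) * f in the next
    lemma. *)
Definition doob_absorb := p / (p - 1) * (2 * (p / (p - 1))) `^ (p - 1).

(** Replaces the Hölder step of Doob's inequality by a pointwise one: half of
    the p-th moment of the maximum is moved to the other side. *)
Lemma powR_absorb (u f : R) : 0 <= u -> 0 <= f ->
  p / (p - 1) * (u `^ (p - 1) * f) <= u `^ p / 2 + doob_absorb * f `^ p.
Proof.
move=> u0 f0; rewrite /doob_absorb; set c := p / (p - 1).
have c0 : 0 < c by rewrite divr_gt0.
have uE : u `^ (p - 1) * u = u `^ p by rewrite mulrC mulr_powRB1.
have fE : f `^ (p - 1) * f = f `^ p by rewrite mulrC mulr_powRB1.
have [cf|cf] := leP (2 * c * f) u.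
  apply: (@le_trans _ _ (u `^ p / 2)).
    rewrite -uE mulrCA -mulrA ler_wpM2l ?powR_ge0 // ler_pdivlMr //.
    by have -> : c * f * 2 = 2 * c * f by ring.
  by rewrite lerDl mulr_ge0 ?powR_ge0 // mulr_ge0 ?powR_ge0 ?(ltW c0).
apply: (@le_trans _ _ (c * (2 * c) `^ (p - 1) * f `^ p)); last first.
  by rewrite lerDr mulr_ge0 ?powR_ge0.
rewrite -mulrA ler_wpM2l ?(ltW c0) // -fE mulrA ler_wpM2r //.
rewrite -powRM //; last by rewrite mulr_ge0 // ltW.
by apply: ge0_ler_powR; rewrite ?nnegrE ?(ltW p1_gt0) ?(ltW cf) // (le_trans u0) // ltW.
Qed.

End PowerInequalities.

Section PowerMeans.
Variables (R : realType) (p : R).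
Hypothesis p_gt1 : 1 < p.
Let p_gt0 : 0 < p. Proof. exact: lt_trans p_gt1. Qed.

(** Jensen's inequality, from the tangent to the power at the average D. *)
Lemma powR_average_le (I : finType) (c y : I -> R) :
  (forall j, 0 <= c j) -> \sum_j c j = 1 -> (forall j, 0 <= y j) ->
  (\sum_j c j * y j) `^ p <= \sum_j c j * y j `^ p.
Proof.
move=> c0 c1 y0; set D := \sum_j c j * y j.
have D0 : 0 <= D by apply: sumr_ge0 => j _; rewrite mulr_ge0.
have tangent j : p * (y j * D `^ (p - 1)) <= y j `^ p + (p - 1) * D `^ p.
  have q0 : 0 < p / (p - 1) by rewrite divr_gt0 // subr_gt0.
  have p1 : p - 1 != 0 by rewrite gt_eqF // subr_gt0.
  have := @conjugate_powR _ (y j) (D `^ (p - 1)) p (p / (p - 1)) (y0 j) (powR_ge0 _ _) p_gt0 q0.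
  rewrite -powRrM [(p - 1) * _]mulrC divfK // invf_div.
  have -> : p^-1 + (p - 1) / p = 1 by field; rewrite gt_eqF.
  move=> /(_ erefl); rewrite -(ler_pM2l p_gt0).
  by have -> : p * (y j `^ p / p + D `^ p * ((p - 1) / p)) =
    y j `^ p + (p - 1) * D `^ p by field; rewrite gt_eqF.
have : \sum_j c j * (p * (y j * D `^ (p - 1))) <=
    \sum_j c j * (y j `^ p + (p - 1) * D `^ p).
  by apply: ler_sum => j _; rewrite ler_wpM2l.
have -> : \sum_j c j * (p * (y j * D `^ (p - 1))) = p * (D * D `^ (p - 1)).
  by rewrite {2}/D mulr_suml mulr_sumr; apply: eq_bigr => j _; ring.
have -> : \sum_j c j * (y j `^ p + (p - 1) * D `^ p) =
    \sum_j c j * y j `^ p + (p - 1) * D `^ p.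
  transitivity (\sum_j (c j * y j `^ p + (p - 1) * D `^ p * c j)).
    by apply: eq_bigr => j _; ring.
  by rewrite big_split /= -mulr_sumr c1 mulr1.
by rewrite mulr_powRB1 //; lra.
Qed.

Lemma powR_add3_le (a b c : R) : 0 <= a -> 0 <= b -> 0 <= c ->
  (a + b + c) `^ p <= 3 `^ p * (a `^ p + b `^ p + c `^ p).
Proof.
move=> a0 b0 c0.
have le3 z : 0 <= z -> a <= z -> b <= z -> c <= z ->
    z `^ p <= a `^ p + b `^ p + c `^ p ->
    (a + b + c) `^ p <= 3 `^ p * (a `^ p + b `^ p + c `^ p).
  move=> z0 az bz cz zp; apply: (@le_trans _ _ ((3 * z) `^ p)).
    apply: ge0_ler_powR; rewrite ?nnegrE ?(ltW p_gt0) //; last by lra.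
      by rewrite !addr_ge0.
    by rewrite mulr_ge0.
  by rewrite powRM // ler_wpM2l ?powR_ge0.
have [ap bp cp] : [/\ 0 <= a `^ p, 0 <= b `^ p & 0 <= c `^ p] by split; exact: powR_ge0.
have [ab|ba] := leP a b; have [bc|cb] := leP b c; have [ac|ca] := leP a c.
- by apply: (le3 c) => //; lra.
- by apply: (le3 c) => //; lra.
- by apply: (le3 b) => //; lra.
- by apply: (le3 b) => //; lra.
- by apply: (le3 c) => //; lra.
- by apply: (le3 a) => //; lra.
- by apply: (le3 a) => //; lra.
- by apply: (le3 a) => //; lra.
Qed.

End PowerMeans.

(** * Words as paths of a Markov chain, and Doob's inequality *)
Section Paths.
Variables (R : realType) (m : nat) (A : 'M[R]_(m + m)) (q : 'rV[R]_(m + m)).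
Implicit Types (w s : seq (letter m)) (F G : seq (letter m) -> R).

(** Words are stored newest letter first, so that the suffixes of a word are the
    past of the path; a letter added to the empty word is drawn from q. *)
Definition step_weight w (j : letter m) : R := if w is i :: _ then A i j else q 0 j.

(** The expectation of F after k more steps, given the past w. *)
Fixpoint cond_exp k F w : R :=
  if k is k'.+1 then \sum_j step_weight w j * cond_exp k' F (j :: w) else F w.

(** The largest of the conditional expectations of F given the suffixes of w,
    when F is to be evaluated k steps after w. *)
Fixpoint running_max F k w : R :=
  if w is _ :: s then Num.max (cond_exp k F w) (running_max F k.+1 s)
  else cond_exp k F w.

Lemma word_weight_cons w j : word_weight A q (j :: w) = step_weight w j * word_weight A q w.
Proof.
case: w => [|i w] /=; first by rewrite mulr1.
by rewrite mulrA mulrC.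
Qed.

Lemma sum_tuple_rcons n (H : seq (letter m) -> R) :
  \sum_(w : n.+1.-tuple (letter m)) H w =
  \sum_j \sum_(w : n.-tuple (letter m)) H (rcons w j).
Proof.
rewrite exchange_big pair_big /=.
rewrite (reindex (fun u : n.-tuple (letter m) * letter m => [tuple of rcons u.1 u.2])) //=.
apply: onW_bij; apply: inj_card_bij.
  move=> [u i] [v j] /= /(congr1 val) /= /rcons_inj [uv ->].
  by congr pair; apply/val_inj.
by rewrite card_prod !card_tuple card_ord expnS mulnC.
Qed.

Lemma cond_exp_tuple k F w :
  word_weight A q w * cond_exp k F w =
  \sum_(u : k.-tuple (letter m)) word_weight A q (u ++ w) * F (u ++ w).
Proof.
elim: k w => [|k IHk] w /=.
  by rewrite (big_pred1 [tuple]) // => u; apply/esym/eqP; exact: tuple0.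
rewrite (sum_tuple_rcons k (fun u => word_weight A q (u ++ w) * F (u ++ w))).
rewrite mulr_sumr; apply: eq_bigr => j _.
rewrite mulrA [X in X * _]mulrC -word_weight_cons IHk.
by apply: eq_bigr => u _; rewrite cat_rcons.
Qed.

Lemma cond_exp_nil k F : cond_exp k F [::] =
  \sum_(u : k.-tuple (letter m)) word_weight A q u * F u.
Proof.
rewrite -[LHS]mul1r (cond_exp_tuple k F [::]).
by apply: eq_bigr => u _; rewrite cats0.
Qed.

Lemma cond_expD k F G w :
  cond_exp k (fun v => F v + G v) w = cond_exp k F w + cond_exp k G w.
Proof.
elim: k w => //= k IHk w; rewrite -big_split /=.
by apply: eq_bigr => j _; rewrite IHk mulrDr.
Qed.

Lemma cond_expZ k c F w : cond_exp k (fun v => c * F v) w = c * cond_exp k F w.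
Proof.
elim: k w => //= k IHk w; rewrite mulr_sumr.
by apply: eq_bigr => j _; rewrite IHk mulrCA.
Qed.

Hypothesis A_ge0 : forall i j, 0 <= A i j.
Hypothesis A_sum1 : forall i, \sum_j A i j = 1.
Hypothesis q_ge0 : forall i, 0 <= q 0 i.
Hypothesis q_sum1 : \sum_i q 0 i = 1.

Lemma step_weight_ge0 w j : 0 <= step_weight w j.
Proof. by case: w => /=. Qed.

Lemma step_weight_sum1 w : \sum_j step_weight w j = 1.
Proof. by case: w => /=. Qed.

Lemma word_weight_ge0 w : 0 <= word_weight A q w.
Proof.
by elim: w => [|j w IHw]; rewrite ?word_weight_cons ?mulr_ge0 ?step_weight_ge0.
Qed.

Lemma cond_exp_cst k c w : cond_exp k (fun=> c) w = c.
Proof.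
elim: k w => //= k IHk w; under eq_bigr do rewrite IHk.
by rewrite -mulr_suml step_weight_sum1 mul1r.
Qed.

Lemma le_cond_exp k F G w : (forall u, size u = k -> F (u ++ w) <= G (u ++ w)) ->
  cond_exp k F w <= cond_exp k G w.
Proof.
elim: k w => [|k IHk] w FG /=; first exact: (FG [::]).
apply: ler_sum => j _; rewrite ler_wpM2l ?step_weight_ge0 // IHk // => u uk.
by rewrite -cat_rcons FG // size_rcons uk.
Qed.

Lemma cond_exp_add a b F w : cond_exp (a + b) F w = cond_exp a (cond_exp b F) w.
Proof. by elim: a w => //= a IHa w; apply: eq_bigr => j _; rewrite IHa. Qed.

Lemma cond_exp_ge0 k F w : (forall v, 0 <= F v) -> 0 <= cond_exp k F w.
Proof. by move=> F0; rewrite -(cond_exp_cst k 0 w); exact: le_cond_exp. Qed.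

Lemma running_max_ge F k u w :
  cond_exp (k + size u) F w <= running_max F k (u ++ w).
Proof.
elim: u k => [|i u IHu] k /=; last by rewrite le_max addnS -addSn IHu orbT.
by rewrite addn0; case: w => [|j w] //=; rewrite le_max lexx.
Qed.

Lemma running_max_ge0 F k w : (forall v, 0 <= F v) -> 0 <= running_max F k w.
Proof.
by move=> F0; case: w => [|i w]; rewrite /= ?le_max cond_exp_ge0.
Qed.

Section Doob.
Variable p : R.
Hypothesis p_gt1 : 1 < p.
Let c := p / (p - 1).

(** Sum of the jumps of the p-th power of the running maximum, in an expectation
    over the future of w. *)
Lemma running_max_telescope F k w : (forall v, 0 <= F v) ->
  cond_exp k (fun v => running_max F 0 v `^ p) w <= running_max F k w `^ p +
  c * cond_exp k (fun v => (running_max F 0 v `^ (p - 1) -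
                            running_max F k w `^ (p - 1)) * F v) w.
Proof.
move=> F0; elim: k w => [|k IHk] w /=; first by rewrite subrr mul0r mulr0 addr0.
set D := running_max F k.+1 w.
have -> : D `^ p = \sum_j step_weight w j * D `^ p.
  by rewrite -mulr_suml step_weight_sum1 mul1r.
rewrite mulr_sumr -big_split /=; apply: ler_sum => j _.
(* Each possible next letter j is treated separately. The new maximum E is
   either D or the conditional expectation given j :: w. *)
rewrite mulrCA -mulrDr ler_wpM2l ?step_weight_ge0 //.
apply: (le_trans (IHk _)).
set E := running_max F k (j :: w).
have -> : cond_exp k (fun v => (running_max F 0 v `^ (p - 1) - D `^ (p - 1)) * F v) (j :: w)
  = cond_exp k (fun v => (running_max F 0 v `^ (p - 1) - E `^ (p - 1)) * F v) (j :: w)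
    + (E `^ (p - 1) - D `^ (p - 1)) * cond_exp k F (j :: w).
  rewrite -cond_expZ -cond_expD; congr cond_exp; apply/funext => v.
  by rewrite -mulrDl addrA subrK.
set X := cond_exp k _ (j :: w).
suff : E `^ p - D `^ p <= c * ((E `^ (p - 1) - D `^ (p - 1)) * cond_exp k F (j :: w)).
  by rewrite [c * (X + _)]mulrDr; lra.
have D0 : 0 <= D by exact: running_max_ge0.
rewrite {X}/E /=; set e := cond_exp k F _.
have [_|De] := ltP e; first by rewrite !subrr mul0r mulr0.
exact: powR_increment_le.
Qed.

(** Doob's L^p inequality; F is a function of words of length N, and the word is
    the only random object here. *)
Lemma doob_ineq N F : (forall v, 0 <= F v) ->
  cond_exp N (fun v => running_max F 0 v `^ p) [::] <=
  2 * doob_absorb p * cond_exp N (fun v => F v `^ p) [::].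
Proof.
move=> F0; have M0 v : 0 <= running_max F 0 v by exact: running_max_ge0.
have p0 : 0 < p by exact: lt_trans p_gt1.
have c1 : 1 <= c by rewrite /c ler_pdivlMr ?subr_gt0 // mul1r lerBlDr lerDl.
suff : cond_exp N (fun v => running_max F 0 v `^ p) [::] <=
    cond_exp N (fun v => c * (running_max F 0 v `^ (p - 1) * F v)) [::].
  move=> /le_trans le1.
  have := le1 (cond_exp N (fun v => 2^-1 * running_max F 0 v `^ p +
                              doob_absorb p * F v `^ p) [::]).
  rewrite cond_expD !cond_expZ => /(_ _) le2.
  have : cond_exp N (fun v => running_max F 0 v `^ p) [::] <=
     2^-1 * cond_exp N (fun v => running_max F 0 v `^ p) [::]
     + doob_absorb p * cond_exp N (fun v => F v `^ p) [::].
    apply: le2; rewrite -!cond_expZ -cond_expD; apply: le_cond_exp => v _.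
    by rewrite [2^-1 * _]mulrC; exact: powR_absorb.
  by move=> H; lra.
apply: (le_trans (running_max_telescope N [::] F0)).
rewrite cond_expZ /=; set D := cond_exp N F [::].
have D0 : 0 <= D by exact: cond_exp_ge0.
have -> : (fun v => (running_max F 0 v `^ (p - 1) - D `^ (p - 1)) * F v) =
  (fun v => running_max F 0 v `^ (p - 1) * F v + - D `^ (p - 1) * F v).
  by apply/funext => v; rewrite mulrDl.
rewrite cond_expD cond_expZ -/D mulrDr addrCA gerDl mulNr mulrN subr_le0.
by rewrite [_ * D]mulrC mulr_powRB1 // ler_peMl // powR_ge0.
Qed.

End Doob.

End Paths.

(** * The walk on letters and points, and path reversal *)
Section Walk.
Variables (R : realType) (m : nat) (X : Type) (tau : letter m -> X -> X).
Variables (A : 'M[R]_(m + m)) (q : 'rV[R]_(m + m)).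
Implicit Types (u w s : seq (letter m)) (F : seq (letter m) -> X -> R).
Implicit Types (f g G : letter m -> X -> R) (x : X).

(** Where the path w leads from x. *)
Definition pos w x := foldr tau x w.

Definition markov_op f : letter m -> X -> R :=
  fun i x => \sum_j A i j * f j (tau i x).

(** The letter is inverted and then updated by A, at the same point: it is P
    without the motion. *)
Definition turn_op f : letter m -> X -> R :=
  fun i x => \sum_j A (linv i) j * f j x.

Definition reverse_word w := rev (map (@linv m) w).

(** The reversed path starts at the end point of the given one. *)
Definition reverse_path F : seq (letter m) -> X -> R :=
  fun w x => F (reverse_word w) (pos w x).

Definition path_max F : seq (letter m) -> X -> R :=
  fun w x => running_max A q (F^~ x) 0 w.

(** The maximal function along the past, read on the reversed path, is a
    maximal function along the future. *)
Definition reverse_max F := reverse_path (path_max F).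

(** f at the newest letter, and at the point where this letter has not yet been
    applied, in accordance with P, which applies the letter i before drawing
    the next one. The empty word has no letter; its value is arbitrary. *)
Definition at_end f : seq (letter m) -> X -> R :=
  fun w x => if w is i :: s then f i (pos s x) else 0.

(** On words with k newer and n older letters around a letter i, F is at least
    f at i and the point where i is about to be applied. *)
Definition dominates_at F k n f := forall u i s x,
  size u = k -> size s = n -> f i (pos s x) <= F (u ++ i :: s) x.

Definition letter_avg f x := \sum_i q 0 i * f i x.

Lemma pos_cat u w x : pos (u ++ w) x = pos u (pos w x).
Proof. exact: foldr_cat. Qed.

Lemma reverse_wordK : involutive reverse_word.
Proof. by move=> w; rewrite /reverse_word map_rev revK mapK //; exact: linvK. Qed.

Lemma size_reverse_word w : size (reverse_word w) = size w.
Proof. by rewrite size_rev size_map. Qed.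

Hypothesis tau_linv : forall i x, tau (linv i) (tau i x) = x.

Lemma pos_reverse_word w x : pos (reverse_word w) (pos w x) = x.
Proof.
elim: w => [//|i w IHw] /=.
by rewrite /reverse_word map_cons rev_cons -cats1 pos_cat /= tau_linv.
Qed.

Lemma cond_exp_at_end k f i s x :
  cond_exp A q k (fun w => at_end f w x) (i :: s) = iter k markov_op f i (pos s x).
Proof. by elim: k i s => //= k IHk i s; apply: eq_bigr => j _; rewrite IHk. Qed.

Hypothesis A_ge0 : forall i j, 0 <= A i j.
Hypothesis A_sum1 : forall i, \sum_j A i j = 1.
Hypothesis q_ge0 : forall i, 0 <= q 0 i.
Hypothesis q_sum1 : \sum_i q 0 i = 1.

Lemma markov_op_le f g : (forall i x, f i x <= g i x) ->
  forall i x, markov_op f i x <= markov_op g i x.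
Proof. by move=> fg i x; apply: ler_sum => j _; rewrite ler_wpM2l. Qed.

Lemma iter_markov_op_le n f g : (forall i x, f i x <= g i x) ->
  forall i x, iter n markov_op f i x <= iter n markov_op g i x.
Proof. by move=> fg; elim: n => //= n IHn; exact: markov_op_le. Qed.

Lemma markov_opZ c f : markov_op (fun i x => c * f i x) = fun i x => c * markov_op f i x.
Proof.
apply/funext => i; apply/funext => x; rewrite /markov_op mulr_sumr.
by apply: eq_bigr => j _; rewrite mulrCA.
Qed.

Lemma iter_markov_opZ n c f :
  iter n markov_op (fun i x => c * f i x) = fun i x => c * iter n markov_op f i x.
Proof. by elim: n => //= n ->; rewrite markov_opZ. Qed.

Lemma path_max_dominates k n f :
  dominates_at (path_max (at_end f)) k n (iter k markov_op f).
Proof.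
move=> u i s x <- _; rewrite -cond_exp_at_end.
exact: (running_max_ge _ _ _ 0).
Qed.

(** On the reversed word the inverse of i has the b letters coming from u in
    its past, and the path passes through the same point. One of the conditional
    expectations in the maximum is the one given this past; it draws a letter j
    with probability A (linv i) j, and F dominates f_j there. *)
Lemma reverse_max_dominates a b F f : dominates_at F a b.+1 f ->
  dominates_at (reverse_max F) b a.+1 (turn_op f).
Proof.
move=> Ff u i s x ub sa; rewrite /reverse_max /reverse_path /path_max.
set v := linv i :: reverse_word u.
have -> : reverse_word (u ++ i :: s) = reverse_word s ++ v.
  by rewrite /reverse_word map_cat rev_cat map_cons rev_cons cat_rcons.
set y := pos (u ++ i :: s) x.
have vy : pos v y = pos s x by rewrite /v /y pos_cat /= pos_reverse_word tau_linv.
apply: le_trans (running_max_ge _ _ _ 0 _ _).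
rewrite add0n size_reverse_word sa /=; apply: ler_sum => j _.
rewrite ler_wpM2l // -vy -[leLHS](cond_exp_cst A_sum1 q_sum1 a _ (j :: v)).
apply: le_cond_exp => // u' u'a; apply: Ff => //.
by rewrite /v /= size_reverse_word ub.
Qed.

(** An odd number of reversals exchanges past and future. *)
Lemma iter_reverse_max_dominates n a b F f : odd n -> dominates_at F a b.+1 f ->
  dominates_at (iter n reverse_max F) b a.+1 (iter n turn_op f).
Proof.
move=> n_odd Ff; rewrite -(odd_double_half n) n_odd add1n /=.
apply: reverse_max_dominates; elim: n./2 => //= k IHk.
by do 2!apply: reverse_max_dominates.
Qed.

(** Averages over words of length a + 2 + b: the a + 1 older letters of the word
    produce the power of P, and the b newer ones are integrated out. *)
Lemma cond_exp_dominates a b F f x : dominates_at F b a.+1 f ->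
  letter_avg (iter a.+1 markov_op f) x <= cond_exp A q (a.+2 + b) (F^~ x) [::].
Proof.
move=> Ff; rewrite cond_exp_add.
apply: (@le_trans _ _ (cond_exp A q a.+2 (fun w => at_end f w x) [::])).
  apply: ler_sum => i _; rewrite ler_wpM2l //.
  by rewrite le_eqVlt; apply/orP; left; apply/eqP/esym; exact: (cond_exp_at_end a.+1 f i [::] x).
apply: le_cond_exp => // -[//|i s] /= [sa]; rewrite cats0.
rewrite -[leLHS](cond_exp_cst A_sum1 q_sum1 b _ (i :: s)).
by apply: le_cond_exp => // u ub; apply: Ff.
Qed.

(** The value P^a g is reached with a newer letters, by the maximum along the
    past; the reversals keep eps times this value, now with a + 1 older
    letters; and a + 1 steps of the chain lead there from the initial point.
    The function on the right does not depend on a, nor does the length of the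
    words if b is adapted to a: this is what makes it a maximal inequality. *)
Lemma letter_avg_le_path_max n eps a b g x : odd n ->
  (forall f, (forall i y, 0 <= f i y) -> forall i y, eps * f i y <= iter n turn_op f i y) ->
  (forall i y, 0 <= g i y) ->
  eps * letter_avg (iter a.*2.+1 markov_op g) x <=
  cond_exp A q (a.+2 + b) (fun w => iter n reverse_max (path_max (at_end g)) w x) [::].
Proof.
move=> n_odd turn_eps g0.
have Pg0 k i y : 0 <= iter k markov_op g i y.
  by elim: k i y => //= k IHk i y; apply: sumr_ge0 => j _; exact: mulr_ge0.
apply: le_trans; last first.
  apply: cond_exp_dominates.
  apply: iter_reverse_max_dominates => //.
  exact: path_max_dominates.
rewrite -addnn -addSn iterD /letter_avg mulr_sumr; apply: ler_sum => i _.
rewrite mulrCA ler_wpM2l //.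
have -> : eps * iter a.+1 markov_op (iter a markov_op g) i x =
    iter a.+1 markov_op (fun j y => eps * iter a markov_op g j y) i x.
  by rewrite iter_markov_opZ.
by apply: iter_markov_op_le => j y; apply: turn_eps.
Qed.

End Walk.

(** The last condition says that the chain started from q, run backwards and
    with inverted letters, has the same law; in particular q is stationary. *)
Record reversible_chain (R : realType) (m : nat) (A : 'M[R]_(m + m))
    (q : 'rV[R]_(m + m)) : Prop := {
  chain_ge0 : forall i j, 0 <= A i j;
  chain_sum1 : forall i, \sum_j A i j = 1;
  chain_law_gt0 : forall i, 0 < q 0 i;
  chain_law_sum1 : \sum_i q 0 i = 1;
  chain_law_linv : forall i, q 0 (linv i) = q 0 i;
  chain_reversible : forall i j, q 0 i * A (linv i) (linv j) = q 0 j * A j i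
}.

Record letter_action (R : realType) (d : measure_display) (X : measurableType d)
    (nu : probability X R) (m : nat) (tau : letter m -> X -> X) : Prop := {
  letter_actionK : forall i x, tau (linv i) (tau i x) = x;
  letter_action_measurable : forall i, measurable_fun setT (tau i);
  letter_action_preserving : forall i B, measurable B -> nu (tau i @^-1` B) = nu B
}.

(** * Reversal invariance and the maximal functions in L^p *)
Section ReverseWeight.
Variables (R : realType) (m : nat) (A : 'M[R]_(m + m)) (q : 'rV[R]_(m + m)).
Hypothesis chain : reversible_chain A q.

Lemma transition_weight_rcons s (a b : letter m) :
  transition_weight A (rcons (rcons s b) a) =
  transition_weight A (rcons s b) * A a b.
Proof.
elim: s => [//|c s /= ->]; case: s => [|e s] /=; first by rewrite !mul1r mulrC.
by rewrite mulrAC.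
Qed.

Lemma word_weight_reverse w :
  word_weight A q (reverse_word w) = word_weight A q w.
Proof.
have weightE s (a : letter m) :
    word_weight A q (rcons s a) = q 0 a * transition_weight A (rcons s a).
  by case: s => //= b s; rewrite last_rcons.
elim: w => [//|i [_|j s IHs]]; first by rewrite /= (chain_law_linv chain).
rewrite word_weight_cons -IHs /reverse_word !map_cons !rev_cons !weightE.
rewrite transition_weight_rcons !(chain_law_linv chain) /=.
set t := transition_weight _ _.
transitivity (q 0 i * A (linv i) (linv j) * t); first by ring.
by rewrite (chain_reversible chain); ring.
Qed.

Lemma chain_stationary j : \sum_i q 0 i * A i j = q 0 j.
Proof.
rewrite (reindex_inj (inv_inj (@linvK m))) /=.
under eq_bigr => i _ do
  rewrite (chain_law_linv chain) -{1}(linvK j) (chain_reversible chain).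
by rewrite -mulr_sumr (chain_sum1 chain) mulr1 (chain_law_linv chain).
Qed.

End ReverseWeight.

Section MaximalInequality.
Variables (R : realType) (d : measure_display) (X : measurableType d).
Variables (nu : probability X R) (m : nat) (tau : letter m -> X -> X).
Variables (A : 'M[R]_(m + m)) (q : 'rV[R]_(m + m)).
Hypothesis action : letter_action nu tau.
Hypothesis chain : reversible_chain A q.
Implicit Types (F : seq (letter m) -> X -> R) (f g : letter m -> X -> R).

Let q_ge0 i : 0 <= q 0 i. Proof. exact: ltW (chain_law_gt0 chain i). Qed.

Local Notation P := (markov_op tau A).

Lemma integral_action (f : X -> R) i : measurable_fun setT f -> (forall x, 0 <= f x) ->
  (\int[nu]_x (f (tau i x))%:E = \int[nu]_x (f x)%:E)%E.
Proof.
move=> mf f0; have mt := letter_action_measurable action i.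
rewrite -[LHS](@ge0_integral_pushforward _ _ _ _ _ _ mt nu setT (EFin \o f)) //.
- by apply: eq_measure_integral => B mB _; exact: letter_action_preserving.
- exact/measurable_EFinP.
- by move=> x _; rewrite lee_fin.
Qed.

Lemma measurable_pos w : measurable_fun setT (pos tau w).
Proof.
elim: w => [|i w IHw]; first exact: measurable_id.
exact: measurableT_comp (letter_action_measurable action i) IHw.
Qed.

Lemma integral_pos (f : X -> R) w : measurable_fun setT f -> (forall x, 0 <= f x) ->
  (\int[nu]_x (f (pos tau w x))%:E = \int[nu]_x (f x)%:E)%E.
Proof.
elim: w f => [//|i w IHw] f mf f0 /=.
rewrite (IHw (f \o tau i)) //= ?integral_action //.
exact: measurableT_comp mf (letter_action_measurable action i).
Qed.

(** Finite combinations of nonnegative functions, whose integrals may be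
    infinite. *)
Lemma integral_comb (I : finType) (c : I -> R) (h : I -> X -> R) :
  (forall i, 0 <= c i) -> (forall i, measurable_fun setT (h i)) ->
  (forall i x, 0 <= h i x) ->
  (\int[nu]_x (\sum_i c i * h i x)%:E = \sum_i (c i)%:E * \int[nu]_x (h i x)%:E)%E.
Proof.
move=> c0 mh h0; under eq_integral do rewrite -sumEFin.
rewrite ge0_integral_sum //.
- apply: eq_bigr => i _; under eq_integral do rewrite EFinM.
  rewrite ge0_integralZl_EFin //; first by move=> x _; rewrite lee_fin.
  exact/measurable_EFinP.
- move=> i; apply/measurable_EFinP/measurable_funM => //; exact: measurable_cst.
- by move=> i x _; rewrite lee_fin mulr_ge0.
Qed.

Lemma measurable_comb (I : finType) (c : I -> R) (h : I -> X -> R) :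
  (forall i, measurable_fun setT (h i)) ->
  measurable_fun setT (fun x => \sum_i c i * h i x).
Proof.
by move=> mh; apply: measurable_sum => i; exact: measurable_funM.
Qed.

Lemma measurable_markov_op f : (forall i, measurable_fun setT (f i)) ->
  forall i, measurable_fun setT (P f i).
Proof.
move=> mf i; apply: measurable_comb => j.
exact: measurableT_comp (mf j) (letter_action_measurable action i).
Qed.

Lemma measurable_iter_markov_op n f : (forall i, measurable_fun setT (f i)) ->
  forall i, measurable_fun setT (iter n P f i).
Proof. by move=> mf; elim: n => //= n; exact: measurable_markov_op. Qed.

Lemma measurable_letter_avg f : (forall i, measurable_fun setT (f i)) ->
  measurable_fun setT (letter_avg q f).
Proof. exact: measurable_comb. Qed.

Lemma markov_op_ge0 f : (forall i x, 0 <= f i x) -> forall i x, 0 <= P f i x.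
Proof. by move=> f0 i x; apply: sumr_ge0 => j _; rewrite mulr_ge0 ?(chain_ge0 chain). Qed.

Lemma iter_markov_op_ge0 n f : (forall i x, 0 <= f i x) ->
  forall i x, 0 <= iter n P f i x.
Proof. by move=> f0; elim: n => //= n; exact: markov_op_ge0. Qed.

(** The product of q and nu is stationary for P. *)
Lemma integral_markov_op f : (forall i, measurable_fun setT (f i)) ->
  (forall i x, 0 <= f i x) ->
  (\int[nu]_x (letter_avg q (P f) x)%:E = \int[nu]_x (letter_avg q f x)%:E)%E.
Proof.
move=> mf f0; have mtau i j : measurable_fun setT (fun x => f j (tau i x)).
  exact: measurableT_comp (mf j) (letter_action_measurable action i).
transitivity (\int[nu]_x (\sum_(k : letter m * letter m)
    (q 0 k.1 * A k.1 k.2) * f k.2 (tau k.1 x))%:E)%E.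
  apply: eq_integral => x _; congr EFin; rewrite /letter_avg /markov_op.
  rewrite -(pair_bigA _ (fun i j => q 0 i * A i j * f j (tau i x))) /=.
  apply: eq_bigr => i _; rewrite mulr_sumr.
  by apply: eq_bigr => j _; rewrite mulrA.
rewrite !integral_comb //; last by move=> k; rewrite mulr_ge0 ?(chain_ge0 chain).
rewrite -(pair_bigA _ (fun i j => (q 0 i * A i j)%:E * \int[nu]_x (f j (tau i x))%:E)%E) /=.
rewrite exchange_big; apply: eq_bigr => j _ /=.
under eq_bigr do rewrite integral_action //.
rewrite -ge0_sume_distrl; last by move=> i _; rewrite lee_fin mulr_ge0 ?(chain_ge0 chain).
by rewrite sumEFin chain_stationary.
Qed.

Lemma integral_iter_markov_op n f : (forall i, measurable_fun setT (f i)) ->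
  (forall i x, 0 <= f i x) ->
  (\int[nu]_x (letter_avg q (iter n P f) x)%:E = \int[nu]_x (letter_avg q f x)%:E)%E.
Proof.
move=> mf f0; elim: n => // n <-; rewrite iterS integral_markov_op //.
- exact: measurable_iter_markov_op.
- exact: iter_markov_op_ge0.
Qed.

(** Integration over words of length k and over their starting point. *)
Definition path_integral k F := (\int[nu]_x (cond_exp A q k (F^~ x) [::])%:E)%E.

Lemma path_integralE k F : (forall w, measurable_fun setT (F w)) ->
  (forall w x, 0 <= F w x) ->
  path_integral k F = (\sum_(w : k.-tuple (letter m))
    (word_weight A q w)%:E * \int[nu]_x (F w x)%:E)%E.
Proof.
move=> mF F0; rewrite /path_integral.
under eq_integral do rewrite cond_exp_nil.
rewrite (integral_comb (h := fun (w : k.-tuple _) => F w)) // => w.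
by apply: word_weight_ge0 => // i j; exact: (chain_ge0 chain).
Qed.

(** The word and its reversal have the same weight, and the passage to the end
    point of a fixed word preserves nu. *)
Lemma path_integral_reverse k F : (forall w, measurable_fun setT (F w)) ->
  (forall w x, 0 <= F w x) ->
  path_integral k (reverse_path tau F) = path_integral k F.
Proof.
move=> mF F0; have mrF w : measurable_fun setT (reverse_path tau F w).
  exact: measurableT_comp (mF (reverse_word w)) (measurable_pos w).
have rF0 w x : 0 <= reverse_path tau F w x by exact: F0.
rewrite !path_integralE //.
pose rv (w : k.-tuple (letter m)) : k.-tuple (letter m) :=
  [tuple of rev [tuple of map (@linv m) w]].
have rvK : involutive rv by move=> w; apply/val_inj; exact: reverse_wordK.
rewrite [RHS](reindex_inj (inv_inj rvK)); apply: eq_bigr => w _.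
rewrite (word_weight_reverse chain) /reverse_path.
by rewrite (integral_pos (f := F (reverse_word w))).
Qed.

Lemma measurable_cond_exp k F w : (forall v, measurable_fun setT (F v)) ->
  measurable_fun setT (fun x => cond_exp A q k (F^~ x) w).
Proof. by move=> mF; elim: k w => //= k IHk w; exact: measurable_comb. Qed.

Lemma measurable_path_max F w : (forall v, measurable_fun setT (F v)) ->
  measurable_fun setT (path_max A q F w).
Proof.
rewrite /path_max => mF; elim: w 0%N => [|i w IHw] k /=; first exact: measurable_cond_exp.
by apply: measurable_maxr => //; exact: measurable_cond_exp.
Qed.

Lemma path_max_ge0 F w x : (forall v x, 0 <= F v x) -> 0 <= path_max A q F w x.
Proof. by move=> F0; apply: running_max_ge0 => //; case: chain. Qed.

Section Power.
Variable p : R.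
Hypothesis p_gt1 : 1 < p.

Lemma measurable_pow (f : X -> R) : measurable_fun setT f ->
  measurable_fun setT (fun x => f x `^ p).
Proof. by move=> mf; exact: (measurableT_comp (measurable_powR p)). Qed.

Lemma path_integral_max k F : (forall w, measurable_fun setT (F w)) ->
  (forall w x, 0 <= F w x) ->
  (path_integral k (fun w x => (path_max A q F w x `^ p)%R) <=
   (2 * doob_absorb p)%:E * path_integral k (fun w x => (F w x `^ p)%R))%E.
Proof.
move=> mF F0; have D0 : 0 <= doob_absorb p.
  by rewrite mulr_ge0 ?powR_ge0 // divr_ge0 // ?subr_ge0 ltW // (lt_trans _ p_gt1).
have ce0 (G : seq (letter m) -> X -> R) x : (forall w x, 0 <= G w x) -> 0 <= cond_exp A q k (G^~ x) [::].
  by move=> G0; apply: cond_exp_ge0 => //; case: chain.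
have pw0 G w (x : X) : 0 <= (G w x : R) `^ p by exact: powR_ge0.
have mp (G : seq (letter m) -> X -> R) : (forall w, measurable_fun setT (G w)) ->
    measurable_fun setT (fun x => (cond_exp A q k (fun w => G w x `^ p) [::])%:E).
  move=> mG; have mGp w : measurable_fun setT (fun x => G w x `^ p).
    exact: (measurable_pow (mG w)).
  by move/measurable_EFinP: (@measurable_cond_exp k (fun w x => G w x `^ p) [::] mGp).
have mF' := mp _ mF.
have mM := mp _ (fun w => measurable_path_max w mF).
have D20 : 0 <= 2 * doob_absorb p by rewrite mulr_ge0.
have F'0 x : (0 <= (cond_exp A q k (fun w => F w x `^ p) [::])%:E)%E.
  by rewrite lee_fin; apply: (ce0 (fun w x => (F w x `^ p)%R)).
have M0 x : (0 <= (cond_exp A q k (fun w => path_max A q F w x `^ p) [::])%:E)%E.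
  by rewrite lee_fin; apply: (ce0 (fun w x => (path_max A q F w x `^ p)%R)).
rewrite -ge0_integralZl_EFin //.
apply: ge0_le_integral => //; first exact: measurable_funeM.
move=> x _; rewrite -EFinM lee_fin.
by apply: doob_ineq => //; case: chain.
Qed.

(** Doob's inequality for every fixed starting point, followed by reversal. *)
Lemma path_integral_reverse_max k F : (forall w, measurable_fun setT (F w)) ->
  (forall w x, 0 <= F w x) ->
  (path_integral k (fun w x => (reverse_max tau A q F w x `^ p)%R) <=
   (2 * doob_absorb p)%:E * path_integral k (fun w x => (F w x `^ p)%R))%E.
Proof.
move=> mF F0; apply: le_trans (path_integral_max k mF F0).
rewrite -[leRHS]path_integral_reverse //.
- by move=> w; apply: measurable_pow; exact: measurable_path_max.
- by move=> w x; exact: powR_ge0.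
Qed.

End Power.

End MaximalInequality.

(** * The weak maximal inequality *)

(** A letter may be unable to turn into itself, so L f need not dominate any
    multiple of f; the inequality is derived for an odd power of L that does. *)
Section WeakMaximal.
Variables (R : realType) (d : measure_display) (X : measurableType d).
Variables (nu : probability X R) (m : nat) (tau : letter m -> X -> X).
Variables (A : 'M[R]_(m + m)) (q : 'rV[R]_(m + m)).
Hypothesis action : letter_action nu tau.
Hypothesis chain : reversible_chain A q.
Implicit Types (F : seq (letter m) -> X -> R) (f g : letter m -> X -> R).

Local Notation P := (markov_op tau A).

Variables (n : nat) (eps : R).
Hypothesis n_odd : odd n.
Hypothesis eps_gt0 : 0 < eps.
Hypothesis turn_eps : forall f : letter m -> X -> R, (forall i y, 0 <= f i y) ->
  forall i y, eps * f i y <= iter n (turn_op A) f i y.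

Variable p : R.
Hypothesis p_gt1 : 1 < p.
Let p_gt0 : 0 < p. Proof. exact: lt_trans p_gt1. Qed.

Local Notation pow f := (fun i x => (f i x `^ p)%R).
Local Notation MM g := (iter n (reverse_max tau A q) (path_max A q (at_end tau g))).

(** Each of the n + 1 maximal functions costs one factor of Doob's constant. *)
Lemma integral_max_path k g : (forall i, measurable_fun setT (g i)) ->
  (forall i x, 0 <= g i x) ->
  [/\ forall w, measurable_fun setT (MM g w), forall w x, 0 <= MM g w x &
  (path_integral nu A q k.+1 (fun w x => (MM g w x `^ p)%R) <=
   ((2 * doob_absorb p) ^+ n.+1)%:E * \int[nu]_x (letter_avg q (pow g) x)%:E)%E].
Proof.
move=> mg g0.
have D0 : 0 <= 2 * doob_absorb p.
  by rewrite mulr_ge0 // mulr_ge0 ?powR_ge0 // divr_ge0 // ?subr_ge0 ltW.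
have me w : measurable_fun setT (at_end tau g w).
  case: w => [|i s]; first exact: measurable_cst.
  exact: measurableT_comp (mg i) (measurable_pos action s).
have e0 w x : 0 <= at_end tau g w x by case: w => /=.
have mG i : measurable_fun setT (fun x => g i x `^ p) by exact: measurable_pow.
have G0 i x : 0 <= g i x `^ p by exact: powR_ge0.
elim: n => [|l [IHm IH0 IH]] /=.
  split; first by move=> w; exact: measurable_path_max.
    by move=> w x; exact: path_max_ge0.
  rewrite expr1; apply: le_trans (path_integral_max nu chain p_gt1 _ me e0) _.
  apply: lee_wpmul2l; first by rewrite lee_fin.
  rewrite -(integral_iter_markov_op action chain k mG G0).
  rewrite le_eqVlt; apply/orP; left; apply/eqP/eq_integral => x _; congr EFin.
  apply: eq_bigr => i _; congr (_ * _).
  rewrite -[RHS](cond_exp_at_end tau A q k (pow g) i [::] x); congr cond_exp.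
  by apply/funext => -[|j s] //=; rewrite powR0 // gt_eqF.
split.
- move=> w; rewrite /reverse_max /reverse_path.
  exact: measurableT_comp (measurable_path_max A q _ IHm) (measurable_pos action w).
- by move=> w x; exact: path_max_ge0.
apply: le_trans (path_integral_reverse_max action chain p_gt1 _ IHm IH0) _.
by rewrite exprS [in leRHS]EFinM -muleA; apply: lee_wpmul2l; rewrite ?lee_fin.
Qed.

(** A conditional expectation at least 2t forces the p-th moment to be at least
    t^p: pointwise M <= t + t^(1-p) M^p, so half of the level is absorbed by the
    term t. *)
Lemma letter_avg_pow_le N a g x lam : (a < N)%N -> 0 < lam ->
  (forall i x, 0 <= g i x) -> lam < letter_avg q (iter a.*2.+1 P g) x ->
  (eps * lam / 2) `^ p <= cond_exp A q N.+1 (fun w => (MM g w x `^ p)%R) [::].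
Proof.
move=> aN lam0 g0 lam_lt; set t := eps * lam / 2.
have [A0 A1 q0 q1 _ _] := chain; have qge0 i : 0 <= q 0 i by exact: ltW.
have t0 : 0 < t by rewrite !mulr_gt0.
have M0 w y : 0 <= MM g w y.
  elim: n w y => [|l IH] w y /=; apply: path_max_ge0 => // {w y} w y.
  by case: w => /=.
have t2 : 2 * t < cond_exp A q N.+1 (fun w => MM g w x) [::].
  (* Words of the single length N + 1 serve for all a < N: the surplus letters
     are newer and play the part of b. *)
  have -> : N.+1 = (a.+2 + (N - a.+1))%N by rewrite addSn subnKC.
  apply: lt_le_trans; last first.
    exact: (letter_avg_le_path_max (letter_actionK action) A0 A1 qge0 q1 _ _ _ n_odd turn_eps).
  by rewrite /t mulrC divfK // ltr_pM2l.
have tp0 : 0 < t `^ (p - 1) by exact: powR_gt0.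
have : cond_exp A q N.+1 (fun w => MM g w x) [::] <=
  cond_exp A q N.+1 (fun w => t + (t `^ (p - 1))^-1 * MM g w x `^ p) [::].
  apply: le_cond_exp => // u _; rewrite cats0; have [Mt|tM] := leP (MM g u x) t.
    by rewrite (le_trans Mt) // lerDl mulr_ge0 ?invr_ge0 ?powR_ge0.
  rewrite (@le_trans _ _ ((t `^ (p - 1))^-1 * MM g u x `^ p)) //; last first.
    by rewrite lerDr ltW.
  rewrite ler_pdivlMl // -[X in _ <= X]mulr_powRB1 // mulrC ler_wpM2l //.
  by apply: ge0_ler_powR; rewrite ?nnegrE ?subr_ge0 ?(ltW t0) ?(ltW tM) ?(ltW p_gt1).
rewrite cond_expD cond_exp_cst // cond_expZ => /(lt_le_trans t2).
rewrite mulr_natl mulr2n ltrD2l ltr_pdivlMl // => /ltW.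
by rewrite mulrC mulr_powRB1 // ltW.
Qed.

Lemma measurable_letter_avg_gt a lam g : (forall i, measurable_fun setT (g i)) ->
  measurable [set x | lam < letter_avg q (iter a.*2.+1 P g) x].
Proof.
move=> mg; have mavg : measurable_fun setT (letter_avg q (iter a.*2.+1 P g)).
  exact: (measurable_letter_avg q (measurable_iter_markov_op A action _ mg)).
have := mavg measurableT _ (measurable_itv `]lam, +oo[).
rewrite setTI; congr measurable; apply/seteqP; split=> x /=;
  by rewrite in_itv /= andbT.
Qed.

Lemma measurable_maximal_set lam g : (forall i, measurable_fun setT (g i)) ->
  measurable [set x | exists a, lam < letter_avg q (iter a.*2.+1 P g) x].
Proof.
move=> mg; rewrite [X in measurable X](_ : _ =
    \bigcup_a [set x | lam < letter_avg q (iter a.*2.+1 P g) x]).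
  by apply: bigcup_measurable => a _; exact: measurable_letter_avg_gt.
by apply/seteqP; split=> x [a]; [exists a|move=> _ ?; exists a].
Qed.

(** The inequality for a < N follows from Markov's inequality applied to the
    iterated maximal function on words of length N + 1, with a constant
    independent of N. *)
Theorem weak_maximal_ineq : exists2 C : R, 0 <= C &
  forall (g : letter m -> X -> R) (lam : R), (forall i, measurable_fun setT (g i)) ->
  (forall i x, 0 <= g i x) -> 0 < lam ->
  (nu [set x | exists a, (lam < letter_avg q (iter a.*2.+1 P g) x)%R] <=
   (C / lam `^ p)%:E * \int[nu]_x (letter_avg q (pow g) x)%:E)%E.
Proof.
have D0 : 0 <= 2 * doob_absorb p.
  by rewrite mulr_ge0 // mulr_ge0 ?powR_ge0 // divr_ge0 // ?subr_ge0 ltW.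
exists ((2 * doob_absorb p) ^+ n.+1 / (eps / 2) `^ p).
  by rewrite divr_ge0 ?powR_ge0 // exprn_ge0.
move=> g lam mg g0 lam0.
pose E N := [set x | exists2 a, (a < N)%N & lam < letter_avg q (iter a.*2.+1 P g) x].
have mE1 a := measurable_letter_avg_gt a lam mg.
have mE N : measurable (E N).
  rewrite [E N](_ : _ = \bigcup_(a in `I_N) [set x | lam < letter_avg q (iter a.*2.+1 P g) x]).
    by apply: bigcup_measurable => a _; exact: mE1.
  by apply/seteqP; split=> x [a aN ?]; exists a.
have EE : [set x | exists a, lam < letter_avg q (iter a.*2.+1 P g) x] = \bigcup_N E N.
  apply/seteqP; split=> [x [a ha]|x [N _ [a _ ha]]]; last by exists a.
  by exists a.+1 => //; exists a.
have ndE : nondecreasing_seq E.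
  move=> N N' NN'; apply/subsetPset => x [a aN ha]; exists a => //.
  exact: leq_trans aN NN'.
have muE := @nondecreasing_cvg_mu _ _ _ nu _ mE (bigcup_measurable (fun k _ => mE k)) ndE.
rewrite EE -(cvg_lim _ muE) //; apply: lime_le; first by apply/cvg_ex; eexists; exact: muE.
near=> N => /=.
have [mM M0 intM] := integral_max_path N mg g0.
have mMp w : measurable_fun setT (fun x => MM g w x `^ p) by exact: (measurable_pow p (mM w)).
have mZ := @measurable_cond_exp _ _ _ _ A q N.+1 (fun w x => MM g w x `^ p) [::] mMp.
set t := (eps * lam / 2) `^ p; have t0 : 0 < t by rewrite powR_gt0 // !mulr_gt0.
pose Z x := cond_exp A q N.+1 (fun w => MM g w x `^ p) [::].
have Z0 x : 0 <= Z x.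
  have [A0 A1 q0 q1 _ _] := chain.
  apply: cond_exp_ge0 => // [i|w]; [exact: ltW (q0 i)|exact: powR_ge0].
have tE : (t%:E * nu (E N) <= path_integral nu A q N.+1 (fun w x => (MM g w x `^ p)%R))%E.
  rewrite -integral_cst //; apply: (@le_trans _ _ (\int[nu]_(x in E N) (Z x)%:E)%E).
    apply: ge0_le_integral => //.
    - by move=> x _; rewrite lee_fin ltW.
    - by apply/measurable_EFinP; exact: measurable_funTS mZ.
    - move=> x [a aN ha]; rewrite lee_fin.
      exact: letter_avg_pow_le aN lam0 g0 ha.
  apply: ge0_subset_integral => //; first exact/measurable_EFinP.
  by move=> x _; rewrite lee_fin.
have -> : (2 * doob_absorb p) ^+ n.+1 / (eps / 2) `^ p / lam `^ p =
    t^-1 * (2 * doob_absorb p) ^+ n.+1.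
  rewrite -mulrA -invfM -powRM ?(ltW lam0) // ?divr_ge0 ?(ltW eps_gt0) //.
  by rewrite mulrC mulrAC.
rewrite EFinM -muleA lee_pdivlMl //; exact: le_trans tE intM.
Unshelve. all: by end_near. Qed.

End WeakMaximal.

(** * Bounded measurable functions *)
Section BoundedMeasurable.
Variables (R : realType) (d : measure_display) (X : measurableType d).
Variable nu : probability X R.
Implicit Types f g : X -> R.

Definition bounded_measurable f :=
  measurable_fun setT f /\ exists M, forall x, `|f x| <= M.

Lemma bounded_measurable_cst c : bounded_measurable (fun=> c).
Proof. by split; [exact: measurable_cst|exists `|c|]. Qed.

Lemma bounded_measurableD f g : bounded_measurable f -> bounded_measurable g ->
  bounded_measurable (fun x => f x + g x).
Proof.
move=> [mf [M fM]] [mg [N gN]]; split; first exact: measurable_funD.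
by exists (M + N) => x; rewrite (le_trans (ler_normD _ _)) // lerD.
Qed.

Lemma bounded_measurableM f g : bounded_measurable f -> bounded_measurable g ->
  bounded_measurable (fun x => f x * g x).
Proof.
move=> [mf [M fM]] [mg [N gN]]; split; first exact: measurable_funM.
by exists (M * N) => x; rewrite normrM ler_pM.
Qed.

Lemma bounded_measurableZ c f : bounded_measurable f ->
  bounded_measurable (fun x => c * f x).
Proof. exact/bounded_measurableM/bounded_measurable_cst. Qed.

Lemma bounded_measurableB f g : bounded_measurable f -> bounded_measurable g ->
  bounded_measurable (fun x => f x - g x).
Proof.
move=> bf bg; have := bounded_measurableD bf (bounded_measurableZ (-1) bg).
by under eq_fun do rewrite mulN1r.
Qed.

Lemma bounded_measurable_sum (I : finType) (h : I -> X -> R) :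
  (forall i, bounded_measurable (h i)) -> bounded_measurable (fun x => \sum_i h i x).
Proof.
move=> bh; elim: (index_enum I) => [|i s IHs].
  by under eq_fun do rewrite big_nil; exact: bounded_measurable_cst.
by under eq_fun do rewrite big_cons; exact: bounded_measurableD.
Qed.

Lemma bounded_measurable_comp f (t : X -> X) : measurable_fun setT t ->
  bounded_measurable f -> bounded_measurable (fun x => f (t x)).
Proof.
by move=> mt [mf [M fM]]; split; [exact: measurableT_comp mf mt|exists M].
Qed.

Definition mean f : R := (\int[nu]_x f x)%R.

Lemma bounded_measurable_integrable f : bounded_measurable f ->
  nu.-integrable setT (EFin \o f).
Proof.
move=> [mf [M fM]]; apply: measurable_bounded_integrable => //.
  by rewrite -ge0_fin_numE // fin_num_measure.
exists M; split; first exact: num_real.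
by move=> N MN x _; exact: le_trans (fM x) (ltW MN).
Qed.

Lemma meanE f : bounded_measurable f -> (mean f)%:E = (\int[nu]_x (f x)%:E)%E.
Proof.
move=> bf; rewrite /mean /Rintegral fineK //.
exact: integrable_fin_num (bounded_measurable_integrable bf).
Qed.

Lemma meanD f g : bounded_measurable f -> bounded_measurable g ->
  mean (fun x => f x + g x) = mean f + mean g.
Proof. by move=> bf bg; apply: RintegralD => //; exact: bounded_measurable_integrable. Qed.

Lemma meanB f g : bounded_measurable f -> bounded_measurable g ->
  mean (fun x => f x - g x) = mean f - mean g.
Proof. by move=> bf bg; apply: RintegralB => //; exact: bounded_measurable_integrable. Qed.

Lemma meanZ c f : bounded_measurable f -> mean (fun x => c * f x) = c * mean f.
Proof. by move=> bf; apply: RintegralZl => //; exact: bounded_measurable_integrable. Qed.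

Lemma mean_cst c : mean (fun=> c) = c.
Proof. by rewrite /mean Rintegral_cst // [X in fine X](probability_setT nu) mulr1. Qed.

Lemma mean_sum (I : finType) (h : I -> X -> R) :
  (forall i, bounded_measurable (h i)) -> mean (fun x => \sum_i h i x) = \sum_i mean (h i).
Proof.
move=> bh; suff [_] : bounded_measurable (fun x => \sum_i h i x) /\
    mean (fun x => \sum_i h i x) = \sum_i mean (h i) by [].
elim: (index_enum I) => [|i s [bs IHs]].
  under eq_fun do rewrite big_nil; rewrite big_nil mean_cst.
  by split=> //; exact: bounded_measurable_cst.
under eq_fun do rewrite big_cons; rewrite big_cons -IHs meanD //.
by split=> //; exact: bounded_measurableD.
Qed.

Lemma mean_ge0 f : (forall x, 0 <= f x) -> 0 <= mean f.
Proof. by move=> f0; apply: Rintegral_ge0. Qed.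

Lemma le_mean f g : bounded_measurable f -> bounded_measurable g ->
  (forall x, f x <= g x) -> mean f <= mean g.
Proof.
by move=> bf bg fg; apply: le_Rintegral => //; exact: bounded_measurable_integrable.
Qed.

End BoundedMeasurable.

(** * Hilbert space structure: P as a flip composed with a self-adjoint turn *)
Section L2.
Variables (R : realType) (d : measure_display) (X : measurableType d).
Variables (nu : probability X R) (m : nat) (tau : letter m -> X -> X).
Variables (A : 'M[R]_(m + m)) (q : 'rV[R]_(m + m)).
Hypothesis action : letter_action nu tau.
Hypothesis chain : reversible_chain A q.
Implicit Types (f g h : letter m -> X -> R).

Local Notation P := (markov_op tau A).
Local Notation L := (@turn_op R m X A).
Local Notation mean := (mean nu).

Definition bounded_vec f := forall i, bounded_measurable (f i).
Definition dot f g := \sum_i q 0 i * mean (fun x => f i x * g i x).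
Definition sqnorm f := dot f f.
Definition vec_sub f g : letter m -> X -> R := fun i x => f i x - g i x.
(** Applies the letter and inverts it, so that a second flip goes back. *)
Definition letter_flip f : letter m -> X -> R := fun i x => f (linv i) (tau i x).

Local Notation U := letter_flip.
(** This is the adjoint of P = U L, see [dot_markov_op]. *)
Definition markov_adj f := L (U f).
Local Notation Pa := markov_adj.

Lemma mean_action (f : X -> R) i : bounded_measurable f ->
  mean (fun x => f (tau i x)) = mean f.
Proof.
move=> [mf [M fM]]; have mt := letter_action_measurable action i.
have bf : bounded_measurable f by split=> //; exists M.
have bft := bounded_measurable_comp mt bf.
have bM := bounded_measurable_cst X M.
apply: (@addIr _ M); rewrite -{1 2}(mean_cst nu M) -!meanD //.
apply: EFin_inj; rewrite !meanE; [|exact: bounded_measurableD..].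
apply: (integral_action action i (f := fun x => f x + M)).
  exact: measurable_funD.
by move=> x; rewrite -lerBlDr sub0r lerNl (le_trans _ (fM x)) // -normrN ler_norm.
Qed.

Lemma bounded_turn_op f : bounded_vec f -> bounded_vec (L f).
Proof. by move=> bf i; apply: bounded_measurable_sum => j; exact: bounded_measurableZ. Qed.

Lemma bounded_letter_flip f : bounded_vec f -> bounded_vec (U f).
Proof.
move=> bf i; exact: bounded_measurable_comp (letter_action_measurable action i) (bf _).
Qed.

Lemma markov_opE f : P f = U (L f).
Proof. by apply/funext => i; apply/funext => x; rewrite /letter_flip /turn_op linvK. Qed.

Lemma letter_flipK f : U (U f) = f.
Proof.
apply/funext => i; apply/funext => x.
by rewrite /letter_flip linvK (letter_actionK action).
Qed.

Lemma bounded_markov_op f : bounded_vec f -> bounded_vec (P f).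
Proof. by move=> bf; rewrite markov_opE; exact/bounded_letter_flip/bounded_turn_op. Qed.

Lemma bounded_markov_adj f : bounded_vec f -> bounded_vec (Pa f).
Proof. by move=> bf; exact/bounded_turn_op/bounded_letter_flip. Qed.

Lemma bounded_iter_markov_op n f : bounded_vec f -> bounded_vec (iter n P f).
Proof. by move=> bf; elim: n => //= n; exact: bounded_markov_op. Qed.

Lemma bounded_iter_markov_adj n f : bounded_vec f -> bounded_vec (iter n Pa f).
Proof. by move=> bf; elim: n => //= n; exact: bounded_markov_adj. Qed.

Lemma bounded_vec_sub f g : bounded_vec f -> bounded_vec g -> bounded_vec (vec_sub f g).
Proof. by move=> bf bg i; exact: bounded_measurableB. Qed.

Lemma dotC f g : dot f g = dot g f.
Proof. by apply: eq_bigr => i _; under [in LHS]eq_fun do rewrite mulrC. Qed.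

Lemma sqnorm_ge0 f : 0 <= sqnorm f.
Proof.
apply: sumr_ge0 => i _; rewrite mulr_ge0 ?(ltW (chain_law_gt0 chain i)) //.
by apply: mean_ge0 => x; rewrite -expr2 sqr_ge0.
Qed.

Lemma sqnorm_sub f g : bounded_vec f -> bounded_vec g ->
  sqnorm (vec_sub f g) = sqnorm f - 2 * dot f g + sqnorm g.
Proof.
move=> bf bg; rewrite /sqnorm /dot mulr_sumr -sumrN -!big_split /=.
apply: eq_bigr => i _.
have -> : (fun x => vec_sub f g i x * vec_sub f g i x) =
    (fun x => f i x * f i x - 2 * (f i x * g i x) + g i x * g i x).
  by apply/funext => x; rewrite /vec_sub; ring.
have bfg := bounded_measurableM (bf i) (bg i).
have bff := bounded_measurableM (bf i) (bf i).
have bgg := bounded_measurableM (bg i) (bg i).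
have b2 := bounded_measurableZ 2 bfg.
rewrite meanD //; last exact: bounded_measurableB.
by rewrite meanB // meanZ //; ring.
Qed.

Lemma dot_letter_flip f g : bounded_vec f -> bounded_vec g ->
  dot (U f) (U g) = dot f g.
Proof.
move=> bf bg; rewrite /dot [RHS](reindex_inj (inv_inj (@linvK m))) /=.
apply: eq_bigr => i _; rewrite (chain_law_linv chain); congr (_ * _).
apply: (mean_action (f := fun x => f (linv i) x * g (linv i) x)).
exact: bounded_measurableM.
Qed.

Lemma turn_symmetric i j : q 0 i * A (linv i) j = q 0 j * A (linv j) i.
Proof.
have := chain_reversible chain i (linv j).
by rewrite linvK (chain_law_linv chain).
Qed.

Lemma dot_turn_op f g : bounded_vec f -> bounded_vec g -> dot (L f) g = dot f (L g).
Proof.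
move=> bf bg.
have dotL h k : bounded_vec h -> bounded_vec k ->
    dot (L h) k = \sum_i \sum_j q 0 i * A (linv i) j * mean (fun x => h j x * k i x).
  move=> bh bk; apply: eq_bigr => i _.
  have -> : (fun x => L h i x * k i x) =
      (fun x => \sum_j A (linv i) j * (h j x * k i x)).
    apply/funext => x; rewrite /turn_op mulr_suml.
    by apply: eq_bigr => j _; rewrite mulrA.
  rewrite mean_sum; last by move=> j; exact/bounded_measurableZ/bounded_measurableM.
  rewrite mulr_sumr; apply: eq_bigr => j _; rewrite meanZ ?mulrA //.
  exact: bounded_measurableM.
rewrite [RHS]dotC !dotL // exchange_big; apply: eq_bigr => i _; apply: eq_bigr => j _ /=.
by rewrite turn_symmetric; under [in LHS]eq_fun do rewrite mulrC.
Qed.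

Lemma dot_markov_op f g : bounded_vec f -> bounded_vec g -> dot (P f) g = dot f (Pa g).
Proof.
move=> bf bg; rewrite markov_opE -{1}(letter_flipK g) dot_letter_flip.
- exact/dot_turn_op/bounded_letter_flip.
- exact: bounded_turn_op.
- exact: bounded_letter_flip.
Qed.

Lemma dot_iter_markov_op n f g : bounded_vec f -> bounded_vec g ->
  dot (iter n P f) g = dot f (iter n Pa g).
Proof.
elim: n g => // n IHn g bf bg; rewrite iterS dot_markov_op ?IHn -?iterSr //.
- exact: bounded_markov_adj.
- exact: bounded_iter_markov_op.
Qed.

(** The matrix of the square of L. *)
Definition turn_sq i j := \sum_k A (linv i) k * A (linv k) j.

Lemma turn_sq_ge0 i j : 0 <= turn_sq i j.
Proof. by apply: sumr_ge0 => k _; rewrite mulr_ge0 ?(chain_ge0 chain). Qed.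

(** The Dirichlet form of the square of L: as L is self-adjoint, |L f|^2 is the
    pairing of f with L (L f), and turn_sq is stochastic and symmetric for q. *)
Lemma sqnorm_defect f : bounded_vec f ->
  2 * (sqnorm f - sqnorm (L f)) =
  \sum_i \sum_j q 0 i * turn_sq i j * mean (fun x => (f i x - f j x) ^+ 2).
Proof.
move=> bf; pose c i j := mean (fun x => f i x * f j x).
have B1 i : \sum_j turn_sq i j = 1.
  rewrite exchange_big /=; under eq_bigr do rewrite -mulr_sumr (chain_sum1 chain) mulr1.
  exact: (chain_sum1 chain).
have Bsym i j : q 0 i * turn_sq i j = q 0 j * turn_sq j i.
  rewrite !mulr_sumr; apply: eq_bigr => k _.
  rewrite mulrA turn_symmetric mulrAC turn_symmetric; ring.
have -> : sqnorm (L f) = \sum_i \sum_j q 0 i * turn_sq i j * c i j.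
  rewrite /sqnorm dot_turn_op //; last exact: bounded_turn_op.
  apply: eq_bigr => i _.
  have -> : (fun x => f i x * L (L f) i x) = (fun x => \sum_j turn_sq i j * (f i x * f j x)).
    apply/funext => x; rewrite /turn_op mulr_sumr.
    under eq_bigr do rewrite !mulr_sumr; rewrite exchange_big /=.
    apply: eq_bigr => j _; rewrite /turn_sq mulr_suml.
    by apply: eq_bigr => k _; ring.
  rewrite mean_sum; last by move=> j; exact/bounded_measurableZ/bounded_measurableM.
  rewrite mulr_sumr; apply: eq_bigr => j _; rewrite meanZ ?mulrA //.
  exact: bounded_measurableM.
have sqE i j : mean (fun x => (f i x - f j x) ^+ 2) = c i i - 2 * c i j + c j j.
  have bb k l : bounded_measurable (fun x => f k x * f l x) by exact: bounded_measurableM.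
  rewrite /c -meanZ // -meanB -?meanD //; last 2 first.
  - by apply: bounded_measurableB => //; exact: bounded_measurableZ.
  - exact: bounded_measurableZ.
  by congr mean; apply/funext => x; ring.
have S1 : sqnorm f = \sum_i \sum_j q 0 i * turn_sq i j * c i i.
  by apply: eq_bigr => i _; rewrite -mulr_suml -mulr_sumr B1 mulr1.
have S2 : sqnorm f = \sum_i \sum_j q 0 i * turn_sq i j * c j j.
  rewrite exchange_big S1; apply: eq_bigr => i _; apply: eq_bigr => j _ /=.
  by rewrite Bsym.
rewrite mulrBr mulr_natl mulr2n {1}S1 S2 mulr_sumr -sumrN -!big_split /=.
apply: eq_bigr => i _; rewrite mulr_sumr -sumrN -!big_split /=.
by apply: eq_bigr => j _; rewrite sqE; ring.
Qed.

End L2.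

(** * Completeness in L^2 for uniformly bounded functions *)
Section L2Limit.
Variables (R : realType) (d : measure_display) (X : measurableType d).
Variable nu : probability X R.
Local Notation mean := (mean nu).

Lemma mean_sq_eq0_ae (f : X -> R) : bounded_measurable f ->
  mean (fun x => f x ^+ 2) = 0 -> {ae nu, forall x, f x = 0}.
Proof.
move=> bf f20.
have bf2 : bounded_measurable (fun x => f x ^+ 2).
  by under eq_fun do rewrite expr2; exact: bounded_measurableM.
have : (\int[nu]_x `|(f x ^+ 2)%:E| = 0)%E.
  under eq_integral => x _ do rewrite gee0_abs ?lee_fin ?sqr_ge0 //.
  by rewrite -meanE // f20.
move/ae_eq_integral_abs => /(_ measurableT) H.
have /H : measurable_fun setT (fun x => (f x ^+ 2)%:E).
  by apply/measurable_EFinP; case: bf2.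
apply: filterS => x /(_ I) /= -[] /eqP; rewrite sqrf_eq0 => /eqP.
exact.
Qed.

Lemma abs_series_fin_cvg (h : nat -> R) :
  (\sum_(j <oo) `|h j.+1 - h j|%:E < +oo)%E -> cvgn h.
Proof.
set S := (\sum_(j <oo) _)%E => Sfin.
have S0 : (0 <= S)%E by apply: nneseries_ge0 => j _ _; rewrite lee_fin.
have SfE : S = (fine S)%:E by rewrite fineK // ge0_fin_numE.
have cvgd : cvgn (series (telescope h)).
  apply: normed_cvg; apply: nondecreasing_is_cvgn.
    by apply: nondecreasing_series => j _ _; exact: normr_ge0.
  exists (fine S) => _ [k _ <-].
  rewrite -lee_fin -SfE /series /= -sumEFin.
  by apply: nneseries_lim_ge => j _ _; rewrite lee_fin.
have -> : h = (fun n => h 0%N + series (telescope h) n).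
  by apply/funext => n; exact: eq_sum_telescope.
exact: is_cvgD (is_cvg_cst _) cvgd.
Qed.

(** Along a fast subsequence the increments have summable integrals, so it
    converges almost everywhere; by dominated convergence the limit is also the
    limit in mean square of the whole sequence. *)
Lemma bounded_L2_complete (h : nat -> X -> R) (M : R) :
  (forall k, measurable_fun setT (h k)) -> (forall k x, `|h k x| <= M) ->
  (forall e, 0 < e -> exists K, forall k l, (K <= k)%N -> (K <= l)%N ->
     mean (fun x => (h k x - h l x) ^+ 2) <= e) ->
  exists v, bounded_measurable v /\
    (mean (fun x => (h k x - v x) ^+ 2) @[k --> \oo] --> (0 : R)).
Proof.
move=> mh hM cauchy.
have bh k : bounded_measurable (h k) by split=> //; exists M.
have bsq (f g : X -> R) : bounded_measurable f -> bounded_measurable g ->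
    bounded_measurable (fun x => (f x - g x) ^+ 2).
  move=> bf bg; under eq_fun do rewrite expr2.
  by apply: bounded_measurableM; exact: bounded_measurableB.
pose half j : R := 2^-1 ^+ j.
have half0 j : 0 < half j by rewrite exprn_gt0 // invr_gt0.
have /choice[K HK] : forall j, exists K, forall k l, (K <= k)%N -> (K <= l)%N ->
    mean (fun x => (h k x - h l x) ^+ 2) <= half j ^+ 2.
  by move=> j; apply: cauchy; exact: exprn_gt0.
(* Since N j >= K j and N j.+1 >= K j, the j-th increment has mean square at
   most 4^-j; the term j makes the subsequence tend to infinity. *)
pose N j := maxn j (\max_(i < j.+1) K i).
have KN i j : (i <= j)%N -> (K i <= N j)%N.
  move=> ij; rewrite leq_max; apply/orP; right.
  exact: (leq_bigmax (F := fun i : 'I_j.+1 => K i) (Ordinal (ij : (i < j.+1)%N))).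
pose w j := h (N j).
have wdiff j : mean (fun x => `|w j.+1 x - w j x|) <= 2 * half j.
  have bw : bounded_measurable (fun x => w j.+1 x - w j x).
    exact: bounded_measurableB (bh _) (bh _).
  have bd : bounded_measurable (fun x => `|w j.+1 x - w j x|).
    split; first by apply: measurableT_comp => //; case: bw.
    by case: bw => _ [B HB]; exists B => x; rewrite normr_id.
  have bs := bsq _ _ (bh (N j.+1)) (bh (N j)).
  have bZ := bounded_measurableZ (half j)^-1 bs.
  (* |y| <= e + y^2 / e with e = 2^-j turns mean squares into means. *)
  apply: (@le_trans _ _ (mean (fun x => half j + (half j)^-1 * (w j.+1 x - w j x) ^+ 2))).
    apply: le_mean => //; first exact: bounded_measurableD (bounded_measurable_cst _ _) bZ.
    move=> x; set y := w j.+1 x - w j x; rewrite -[y ^+ 2]real_normK ?num_real //.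
    have := normr_ge0 y; set z := `|y| => z0.
    have [zh|hz] := leP z (half j).
      by rewrite (le_trans zh) // lerDl mulr_ge0 ?sqr_ge0 // invr_ge0 ltW.
    rewrite (@le_trans _ _ ((half j)^-1 * z ^+ 2)) //; last by rewrite lerDr ltW.
    by rewrite ler_pdivlMl // expr2 ler_wpM2r // ltW.
  rewrite meanD //; last exact: bounded_measurable_cst.
  rewrite mean_cst meanZ // mulr_natl mulr2n lerD2l ler_pdivrMl // -expr2.
  by apply: HK; exact: KN.
have w_cvg : {ae nu, forall x, cvgn (w^~ x)}.
  pose S x := (\sum_(j <oo) `|w j.+1 x - w j x|%:E)%E.
  have md j : measurable_fun setT (fun x => `|w j.+1 x - w j x|%:E).
    apply/measurable_EFinP/measurableT_comp => //.
    by apply: measurable_funB; exact: mh.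
  have Sint : (\int[nu]_x S x < +oo)%E.
    rewrite integral_nneseries //.
    apply: (@le_lt_trans _ _ (\sum_(j <oo) (2 * half j)%:E)%E).
      apply: lee_nneseries => [j _ _|j _]; first by apply: integral_ge0.
      rewrite -meanE ?lee_fin //; split; first by apply/measurable_EFinP; exact: md.
      exists (M + M) => x; rewrite normr_id (le_trans (ler_normB _ _)) //.
      by apply: lerD; exact: hM.
    have := @cvg_geometric_eseries_half R 4 0; rewrite expr0 divr1.
    rewrite (_ : (fun k => _) = (fun k => (2 * half k)%:E)); last first.
      apply/funext => k; rewrite natrX addn1 exprS /half exprVn; congr EFin.
      by rewrite invfM mulrA; congr (_ * _); field.
    by move=> /cvg_lim -> //; exact: ltry.
  have mS : measurable_fun setT S.
    apply: (ge0_emeasurable_sum (P := xpredT)) => [j x _ _|j _]; last exact: md.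
    by rewrite lee_fin.
  have iS : nu.-integrable setT S.
    apply/integrableP; split => //; rewrite (eq_integral S) // => x _.
    by rewrite gee0_abs //; apply: nneseries_ge0 => j _ _; rewrite lee_fin.
  have := integrable_ae measurableT iS; apply: filterS => x /(_ I) Sx.
  by apply: abs_series_fin_cvg; rewrite ltey_eq; move: Sx; rewrite /S => ->.
(* The clamp makes the limit bounded also where the subsequence diverges. *)
pose v x := Num.max (- M) (Num.min M (limn_sup (w^~ x))).
have M0 : 0 <= M by exact: le_trans (normr_ge0 _) (hM 0%N point).
have vM x : `|v x| <= M.
  by rewrite ler_norml le_max lexx ge_max ge_min lexx /= andbT ge0_cp.
have mv : measurable_fun setT v.
  apply: measurable_maxr => //; apply: measurable_minr => //.
  apply: measurable_fun_limn_sup => [x _|x _|n].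
  - by exists M => _ [k _ <-]; rewrite (le_trans (ler_norm _)) // hM.
  - by exists (- M) => _ [k _ <-]; rewrite lerNl (le_trans _ (hM (N k) x)) // -normrN ler_norm.
  - exact: mh.
have bv : bounded_measurable v by split=> //; exists M.
have wv : {ae nu, forall x, w^~ x @ \oo --> v x}.
  apply: filterS w_cvg => x wx.
  have lM : `|limn (w^~ x)| <= M.
    have wM k : - M <= w k x <= M by rewrite -ler_norml hM.
    by rewrite ler_norml; apply/andP; split; [apply: limr_ge|apply: limr_le];
      rewrite //; apply: nearW => k; have /andP[] := wM k.
  rewrite /v cvg_limn_supE //.
  move: lM; rewrite ler_norml => /andP[l1 l2].
  by rewrite (min_idPr l2) (max_idPr l1).
exists v; split => //.
apply/cvgrPdist_le => e e0; have [K0 HK0] := cauchy _ e0.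
near=> k; rewrite sub0r normrN ger0_norm; last by apply: mean_ge0 => x; exact: sqr_ge0.
have mhw (g : X -> R) : measurable_fun setT g ->
    measurable_fun setT (fun x => ((h k x - g x) ^+ 2)%:E).
  by move=> mg; apply/measurable_EFinP/measurable_funX; exact: measurable_funB.
have [|||||_ _] := @dominated_convergence _ X R nu setT measurableT
  (fun j x => ((h k x - w j x) ^+ 2)%:E) (fun x => ((h k x - v x) ^+ 2)%:E)
  (cst ((M + M) ^+ 2)%:E).
- by move=> j; apply: mhw; exact: mh.
- exact: mhw mv.
- apply: filterS wv => x wx _; apply: cvg_EFin; first exact: nearW.
  rewrite (_ : _ \o _ = fun j => (h k x - w j x) * (h k x - w j x)); last first.
    by apply/funext => j /=; rewrite expr2.
  by rewrite expr2; apply: cvgM; apply: cvgB => //; exact: cvg_cst.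
- exact: finite_measure_integrable_cst.
- apply: aeW => x j _; rewrite gee0_abs ?lee_fin ?sqr_ge0 //.
  rewrite -[leLHS]real_normK ?num_real // ler_sqr ?nnegrE ?addr_ge0 //.
  by rewrite (le_trans (ler_normB _ _)) // lerD // hM.
move=> dc; rewrite -lee_fin meanE; last exact: bsq (bh _) bv.
rewrite -(cvg_lim _ dc) //; apply: lime_le; first by apply/cvg_ex; eexists; exact: dc.
near=> j => /=; rewrite -meanE; last exact: bsq (bh _) (bh _).
rewrite lee_fin; apply: HK0; first by near: k; exact: nbhs_infty_ge.
apply: (@leq_trans j); first by near: j; exact: nbhs_infty_ge.
by rewrite leq_max leqnn.
Unshelve. all: by end_near. Qed.

End L2Limit.

(** * Mean convergence of the odd iterates of P *)
Lemma cvg0_le (R : realType) (u v : nat -> R) : (forall k, 0 <= u k <= v k) ->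
  v @ \oo --> (0 : R) -> u @ \oo --> (0 : R).
Proof.
move=> uv v0; apply: (squeeze_cvgr (f := fun=> 0) (h := v)) => //.
  exact: nearW.
exact: cvg_cst.
Qed.

Lemma cvg0_comb2 (R : realType) (a b : R) (u v : nat -> R) :
  u @ \oo --> (0 : R) -> v @ \oo --> (0 : R) ->
  (fun k => a * u k + b * v k) @ \oo --> (0 : R).
Proof.
move=> u0 v0; have : a * u k + b * v k @[k --> \oo] --> a * 0 + b * 0.
  by apply: cvgD; apply: cvgMr.
by rewrite !mulr0 addr0.
Qed.

Lemma cvg0_sum (R : realType) (I : Type) (s : seq I) (u : I -> nat -> R) :
  (forall i, u i @ \oo --> (0 : R)) -> (fun k => \sum_(i <- s) u i k) @ \oo --> (0 : R).
Proof.
move=> u0; elim: s => [|i s IHs].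
  by under eq_fun do rewrite big_nil; exact: cvg_cst.
under eq_fun do rewrite big_cons.
have := cvg0_comb2 1 1 (u0 i) IHs.
by under eq_fun do rewrite !mul1r.
Qed.

(** The difference of both sides is a variance. *)
Lemma sqr_average_le (R : realType) (I : finType) (c y : I -> R) :
  (forall j, 0 <= c j) -> \sum_j c j = 1 ->
  (\sum_j c j * y j) ^+ 2 <= \sum_j c j * y j ^+ 2.
Proof.
move=> c0 c1; set D := \sum_j c j * y j; rewrite -subr_ge0.
have -> : \sum_j c j * y j ^+ 2 - D ^+ 2 = \sum_j c j * (y j - D) ^+ 2.
  transitivity (\sum_j (c j * y j ^+ 2 - 2 * D * (c j * y j) + D ^+ 2 * c j)).
    by rewrite big_split /= sumrB -!mulr_sumr -/D c1; ring.
  by apply: eq_bigr => j _; ring.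
by apply: sumr_ge0 => j _; rewrite mulr_ge0 ?sqr_ge0.
Qed.

(** The connectedness hypothesis below is the irreducibility of the square of
    the turn matrix, in the form of an induction principle: a transitive relation
    that holds along the positive entries holds everywhere. *)
Section L2Convergence.
Variables (R : realType) (d : measure_display) (X : measurableType d).
Variables (nu : probability X R) (m : nat) (tau : letter m -> X -> X).
Variables (A : 'M[R]_(m + m)) (q : 'rV[R]_(m + m)).
Hypothesis action : letter_action nu tau.
Hypothesis chain : reversible_chain A q.
Hypothesis turn_sq_connected : forall S : letter m -> letter m -> Prop,
  (forall i j k, S i j -> S j k -> S i k) ->
  (forall i j, 0 < turn_sq A i j -> S i j) -> forall i j, S i j.
Implicit Types (f g h : letter m -> X -> R).

Local Notation P := (markov_op tau A).
Local Notation L := (@turn_op R m X A).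
Local Notation U := (@letter_flip R d X m tau).
Local Notation Pa := (markov_adj tau A).
Local Notation mean := (mean nu).
Local Notation sqnorm := (sqnorm nu q).
Local Notation dot := (dot nu q).

Let A_ge0 := chain_ge0 chain.
Let A_sum1 := chain_sum1 chain.
Let q_ge0 i : 0 <= q 0 i. Proof. exact: ltW (chain_law_gt0 chain i). Qed.

Lemma bounded_sq_sub (u v : X -> R) : bounded_measurable u -> bounded_measurable v ->
  bounded_measurable (fun x => (u x - v x) ^+ 2).
Proof.
move=> bu bv; under eq_fun do rewrite expr2.
by apply: bounded_measurableM; exact: bounded_measurableB.
Qed.

Lemma mean_sq_triangle (u v w : X -> R) :
  bounded_measurable u -> bounded_measurable v -> bounded_measurable w ->
  mean (fun x => (u x - w x) ^+ 2) <=
  2 * mean (fun x => (u x - v x) ^+ 2) + 2 * mean (fun x => (v x - w x) ^+ 2).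
Proof.
move=> bu bv bw.
have b1 := bounded_sq_sub bu bv; have b2 := bounded_sq_sub bv bw.
have b3 := bounded_sq_sub bu bw.
rewrite -!meanZ // -meanD; [|exact: bounded_measurableZ..].
apply: le_mean => //.
  exact: bounded_measurableD (bounded_measurableZ _ b1) (bounded_measurableZ _ b2).
move=> x; rewrite -subr_ge0.
have -> : 2 * (u x - v x) ^+ 2 + 2 * (v x - w x) ^+ 2 - (u x - w x) ^+ 2 =
    (u x - v x - (v x - w x)) ^+ 2 by ring.
exact: sqr_ge0.
Qed.

Lemma mean_sq_sym (u v : X -> R) :
  mean (fun x => (u x - v x) ^+ 2) = mean (fun x => (v x - u x) ^+ 2).
Proof. by congr mean; apply/funext => x; ring. Qed.

Lemma sqnorm_turn_op f : bounded_vec f -> sqnorm (L f) <= sqnorm f.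
Proof.
move=> bf; rewrite -subr_ge0 -(pmulr_rge0 _ (ltr0n R 2)) (sqnorm_defect nu chain bf).
apply: sumr_ge0 => i _; apply: sumr_ge0 => j _.
rewrite mulr_ge0 ?mulr_ge0 ?(turn_sq_ge0 chain) //.
by apply: mean_ge0 => x; exact: sqr_ge0.
Qed.

Lemma sqnorm_letter_flip f : bounded_vec f -> sqnorm (U f) = sqnorm f.
Proof. by move=> bf; exact: (dot_letter_flip action chain bf bf). Qed.

Lemma sqnorm_markov_opE f : bounded_vec f -> sqnorm (P f) = sqnorm (L f).
Proof. by move=> bf; rewrite markov_opE sqnorm_letter_flip //; exact: bounded_turn_op. Qed.

Lemma sqnorm_markov_op f : bounded_vec f -> sqnorm (P f) <= sqnorm f.
Proof. by move=> bf; rewrite sqnorm_markov_opE // sqnorm_turn_op. Qed.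

Lemma sqnorm_iter_markov_op n f : bounded_vec f -> sqnorm (iter n P f) <= sqnorm f.
Proof.
move=> bf; elim: n => //= n; apply: le_trans; apply: sqnorm_markov_op.
exact: (bounded_iter_markov_op A action n bf).
Qed.

Lemma sqnorm_iter_markov_adj n f : bounded_vec f -> sqnorm (iter n Pa f) <= sqnorm f.
Proof.
move=> bf; elim: n => //= n IHn.
have b := bounded_iter_markov_adj A action n bf.
rewrite (le_trans (sqnorm_turn_op _)) //; first exact: (bounded_letter_flip action).
by rewrite sqnorm_letter_flip.
Qed.

Lemma turn_op_sub f g : L (vec_sub f g) = vec_sub (L f) (L g).
Proof.
apply/funext => i; apply/funext => x; rewrite /vec_sub /turn_op -sumrB.
by apply: eq_bigr => j _; rewrite mulrBr.
Qed.

Lemma iter_markov_op_sub n f g :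
  iter n P (vec_sub f g) = vec_sub (iter n P f) (iter n P g).
Proof. by elim: n => //= n ->; rewrite !markov_opE turn_op_sub. Qed.

Lemma iter_markov_adj_sub n f g :
  iter n Pa (vec_sub f g) = vec_sub (iter n Pa f) (iter n Pa g).
Proof. by elim: n => //= n ->; rewrite /markov_adj -turn_op_sub. Qed.

Lemma letter_flip_sub f g : U (vec_sub f g) = vec_sub (U f) (U g).
Proof. by []. Qed.

(** P* = L U = U (U L) U. *)
Lemma iter_markov_adjE n f : iter n Pa f = U (iter n P (U f)).
Proof.
elim: n f => [|n IHn] f; first by rewrite (letter_flipK action).
by rewrite iterS IHn /markov_adj (letter_flipK action) iterS [P _]markov_opE (letter_flipK action).
Qed.

Lemma sqnorm_sub_triangle f g h : bounded_vec f -> bounded_vec g -> bounded_vec h ->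
  sqnorm (vec_sub f h) <= 2 * sqnorm (vec_sub f g) + 2 * sqnorm (vec_sub g h).
Proof.
move=> bf bg bh; rewrite /sqnorm /dot !mulr_sumr -big_split /=; apply: ler_sum => i _.
rewrite [leRHS](_ : _ = q 0 i * (2 * mean (fun x => (f i x - g i x) ^+ 2) +
    2 * mean (fun x => (g i x - h i x) ^+ 2))); last by rewrite mulrDr !(mulrCA (q 0 i)).
rewrite ler_wpM2l //; exact: mean_sq_triangle.
Qed.

Lemma sqnorm_sub_sym f g : sqnorm (vec_sub f g) = sqnorm (vec_sub g f).
Proof.
by apply: eq_bigr => i _; congr (_ * mean _); apply/funext => x; rewrite /vec_sub; ring.
Qed.

(** The adjoint iterates are contractions, which reduces the claim to
    |u - P*^k P^k u|^2 <= |u|^2 - |P^k u|^2 for u = P^n f; expanding the square,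
    the cross term is -2 |P^k u|^2 and the last one is at most |P^k u|^2. *)
Lemma sqnorm_sub_adj n k f : bounded_vec f ->
  sqnorm (vec_sub (iter n Pa (iter n P f)) (iter (k + n) Pa (iter (k + n) P f))) <=
  sqnorm (iter n P f) - sqnorm (iter (k + n) P f).
Proof.
move=> bf; have -> : iter (k + n) Pa = iter (n + k) Pa by rewrite addnC.
rewrite !iterD -iter_markov_adj_sub.
set u := iter n P f.
have bu : bounded_vec u by exact: (bounded_iter_markov_op A action).
have bPu := bounded_iter_markov_op A action k bu.
have bPaPu := bounded_iter_markov_adj A action k bPu.
apply: le_trans (sqnorm_iter_markov_adj n (bounded_vec_sub bu bPaPu)) _.
rewrite (sqnorm_sub nu q bu bPaPu) -(dot_iter_markov_op action chain k bu bPu).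
have := sqnorm_iter_markov_adj k bPu; rewrite /sqnorm => H; lra.
Qed.

Section Orbit.
Variable g : letter m -> X -> R.
Hypothesis bg : bounded_vec g.

Local Notation energy k := (sqnorm (iter k P g)).
Let bP k : bounded_vec (iter k P g). Proof. exact: (bounded_iter_markov_op A action). Qed.

Lemma energy_is_cvg : cvgn (fun k => energy k).
Proof.
apply: nonincreasing_is_cvgn.
  by apply/nonincreasing_seqP => k; exact: sqnorm_markov_op (bP k).
by exists 0 => _ [k _ <-]; exact: (sqnorm_ge0 nu chain).
Qed.

Lemma energy_increment_cvg0 : energy k - energy k.+1 @[k --> \oo] --> (0 : R).
Proof.
have cv := energy_is_cvg; rewrite -(subrr (limn (fun k => energy k))).
by apply: cvgB => //; rewrite (cvg_shiftS (fun k => energy k)).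
Qed.

(** The defect of energy controls the difference of two letters joined by an
    entry of turn_sq; chains of such letters reach all pairs. *)
Lemma letter_diff_cvg0 i j :
  mean (fun x => (iter k P g i x - iter k P g j x) ^+ 2) @[k --> \oo] --> (0 : R).
Proof.
apply: (turn_sq_connected (S := fun i j =>
  mean (fun x => (iter k P g i x - iter k P g j x) ^+ 2) @[k --> \oo] --> (0 : R))).
- move=> {}i l {}j il lj.
  apply: cvg0_le (cvg0_comb2 2 2 il lj) => k.
  apply/andP; split; first by apply: mean_ge0 => x; exact: sqr_ge0.
  exact: mean_sq_triangle (bP k i) (bP k l) (bP k j).
- move=> {}i {}j Bij; have qB : 0 < q 0 i * turn_sq A i j by rewrite mulr_gt0 ?(chain_law_gt0 chain).
  apply: cvg0_le (cvg0_comb2 ((q 0 i * turn_sq A i j)^-1 * 2) 0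
    energy_increment_cvg0 energy_increment_cvg0) => k.
  apply/andP; split; first by apply: mean_ge0 => x; exact: sqr_ge0.
  have term_ge0 l l' : 0 <= q 0 l * turn_sq A l l' *
      mean (fun x => (iter k P g l x - iter k P g l' x) ^+ 2).
    rewrite mulr_ge0 ?mulr_ge0 ?(turn_sq_ge0 chain) //.
    by apply: mean_ge0 => x; exact: sqr_ge0.
  rewrite mul0r addr0 -mulrA ler_pdivlMl // iterS sqnorm_markov_opE // sqnorm_defect //.
  rewrite (bigD1 i) //= (bigD1 j) //= -addrA lerDl addr_ge0 ?sumr_ge0 //.
  by move=> l _; apply: sumr_ge0.
Qed.

Local Notation u k := (iter k.*2.+1 P g).
Local Notation v k := (U (iter k.+1 Pa (iter k.+1 P g))).

(** U P*^(k+1) = P^(k+1) U, and U P = L. *)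
Lemma reflected_orbitE k : v k = iter k.+1 P (L (iter k P g)).
Proof.
by rewrite iter_markov_adjE (letter_flipK action) [iter k.+1 P g]iterS markov_opE (letter_flipK action).
Qed.

(** The difference is P^(k+1) applied to P^k g - L P^k g, whose i-th coordinate
    averages differences of the coordinates of P^k g. *)
Lemma orbit_sub_reflected_cvg0 : sqnorm (vec_sub (u k) (v k)) @[k --> \oo] --> (0 : R).
Proof.
apply: (@cvg0_le _ _ (fun k => \sum_i \sum_j q 0 i * A (linv i) j *
  mean (fun x => (iter k P g i x - iter k P g j x) ^+ 2))); last first.
  apply: cvg0_sum => i; apply: cvg0_sum => j.
  have := cvg0_comb2 (q 0 i * A (linv i) j) 0 (letter_diff_cvg0 i j) (letter_diff_cvg0 i j).
  by under eq_fun do rewrite mul0r addr0.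
move=> k; rewrite (sqnorm_ge0 nu chain) andTb reflected_orbitE -addnn -addSn iterD.
have bc := bP k; set c := iter k P g in bc *; have bL := bounded_turn_op A bc.
rewrite -iter_markov_op_sub.
apply: le_trans (sqnorm_iter_markov_op _ (bounded_vec_sub bc bL)) _.
apply: ler_sum => i _.
have -> : \sum_j q 0 i * A (linv i) j * mean (fun x => (c i x - c j x) ^+ 2) =
    q 0 i * mean (fun x => \sum_j A (linv i) j * (c i x - c j x) ^+ 2).
  rewrite mean_sum; last by move=> j; exact/bounded_measurableZ/bounded_sq_sub.
  rewrite mulr_sumr; apply: eq_bigr => j _; rewrite meanZ ?mulrA //.
  exact: bounded_sq_sub.
rewrite ler_wpM2l //; apply: le_mean.
- by apply: bounded_measurableM; exact: bounded_measurableB.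
- by apply: bounded_measurable_sum => j; exact/bounded_measurableZ/bounded_sq_sub.
- move=> x; rewrite -expr2; apply: le_trans (sqr_average_le _ _ _) => //.
  rewrite /vec_sub /turn_op le_eqVlt; apply/orP; left; apply/eqP; congr (_ ^+ 2).
  rewrite -[c i x in LHS]mul1r -(A_sum1 (linv i)) mulr_suml -sumrB.
  by apply: eq_bigr => j _; rewrite mulrBr.
Qed.

(** Up to an error that vanishes, P^(2k+1) g is the flip of P*^(k+1) P^(k+1) g,
    and the increments of the latter are bounded by those of the energy. *)
Lemma orbit_cauchy e : 0 < e -> exists K, forall k l, (K <= k)%N -> (K <= l)%N ->
  sqnorm (vec_sub (u k) (u l)) <= e.
Proof.
move=> e0; have e16 : 0 < e / 16 by rewrite divr_gt0.
have /cvgrPdist_le/(_ _ e16)[K1 _ HK1] := orbit_sub_reflected_cvg0.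
have /cvgrPdist_le/(_ _ e16)[K2 _ HK2] := energy_is_cvg.
exists (maxn K1 K2) => k l; rewrite !geq_max => /andP[k1 k2] /andP[l1 l2].
have bu j : bounded_vec (u j) by exact: bP.
have bv j : bounded_vec (v j).
  by rewrite reflected_orbitE; apply: (bounded_iter_markov_op A action); exact: bounded_turn_op.
have uv j : (K1 <= j)%N -> sqnorm (vec_sub (u j) (v j)) <= e / 16.
  by move=> /HK1 /=; rewrite sub0r normrN ger0_norm // (sqnorm_ge0 nu chain).
have en j : (K2 <= j)%N -> `|energy j.+1 - limn (fun k => energy k)| <= e / 16.
  by move=> j2; rewrite distrC; apply: HK2; exact: leqW.
have vv : sqnorm (vec_sub (v k) (v l)) <= e / 8.
  wlog kl : k l k2 l2 {k1 l1} / (k <= l)%N.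
    by move=> H; case/orP: (leq_total k l) => /H; [exact|rewrite sqnorm_sub_sym; exact].
  rewrite -letter_flip_sub sqnorm_letter_flip; last first.
    by apply: bounded_vec_sub; apply: (bounded_iter_markov_adj A action).
  have := sqnorm_sub_adj k.+1 (l - k) bg; rewrite addnS subnK // => /le_trans; apply.
  have := en k k2; have := en l l2; rewrite !ler_norml; lra.
have t1 := sqnorm_sub_triangle (bu k) (bv k) (bu l).
have t2 := sqnorm_sub_triangle (bv k) (bv l) (bu l).
have := uv k k1; have := uv l l1; rewrite sqnorm_sub_sym; lra.
Qed.

Lemma bounded_vec_bound f : bounded_vec f -> exists M, forall i x, `|f i x| <= M.
Proof.
move=> bf; have /choice[M fM] : forall i, exists M, forall x, `|f i x| <= M.
  by move=> i; case: (bf i).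
exists (\sum_i `|M i|) => i x; rewrite (le_trans (fM i x)) // (le_trans (ler_norm _)) //.
by rewrite (bigD1 i) //= lerDl sumr_ge0.
Qed.

Lemma iter_markov_op_bound M f n : (forall i x, `|f i x| <= M) ->
  forall i x, `|iter n P f i x| <= M.
Proof.
move=> fM; elim: n => //= n IHn i x; rewrite (le_trans (ler_norm_sum _ _ _)) //.
rewrite -[leRHS]mul1r -(A_sum1 i) mulr_suml; apply: ler_sum => j _.
by rewrite normrM ger0_norm // ler_wpM2l.
Qed.

Lemma mean_le_sqnorm f h i : bounded_vec f -> bounded_vec h ->
  mean (fun x => (f i x - h i x) ^+ 2) <= (q 0 i)^-1 * sqnorm (vec_sub f h).
Proof.
move=> bf bh; rewrite ler_pdivlMl ?(chain_law_gt0 chain) // /sqnorm /dot (bigD1 i) //=.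
rewrite -[leLHS]addr0 lerD //.
apply: sumr_ge0 => j _; rewrite mulr_ge0 //; apply: mean_ge0 => x.
by rewrite -expr2 sqr_ge0.
Qed.

(** P (P w) = w because P^2 maps the k-th odd iterate to the next one, and the
    coordinates of w and P w agree as limits of P^n g with n odd and even,
    respectively. *)
Theorem bounded_orbit_limit : exists w, [/\ bounded_vec w,
  sqnorm (vec_sub (u k) w) @[k --> \oo] --> (0 : R),
  sqnorm (vec_sub (P (P w)) w) = 0,
  (forall i j, mean (fun x => (w i x - w j x) ^+ 2) = 0) &
  (forall i j, mean (fun x => (P w i x - P w j x) ^+ 2) = 0)].
Proof.
have [M gM] := bounded_vec_bound bg.
have /choice[w Hw] : forall i, exists w, bounded_measurable w /\
    (mean (fun x => (u k i x - w x) ^+ 2) @[k --> \oo] --> (0 : R)).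
  move=> i; apply: (@bounded_L2_complete _ _ _ _ (fun k => u k i) M).
  - by move=> k; case: (bP k.*2.+1 i).
  - by move=> k x; exact: iter_markov_op_bound.
  - move=> e e0; have qe : 0 < q 0 i * e by rewrite mulr_gt0 ?(chain_law_gt0 chain).
    have [K HK] := orbit_cauchy qe; exists K => k l Kk Kl.
    apply: le_trans (mean_le_sqnorm i (bP _) (bP _)) _.
    by rewrite ler_pdivrMl ?(chain_law_gt0 chain) // HK.
have bw : bounded_vec w by move=> i; case: (Hw i).
have uw : sqnorm (vec_sub (u k) w) @[k --> \oo] --> (0 : R).
  apply: cvg0_sum => i.
  have := cvg0_comb2 (q 0 i) 0 (Hw i).2 (Hw i).2.
  by under eq_fun do rewrite mul0r addr0.
have null (c : R) (s : nat -> R) : 0 <= c -> (forall k, c <= s k) ->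
    s @ \oo --> (0 : R) -> c = 0.
  move=> c0 cs s0; apply/eqP; rewrite eq_le c0 andbT.
  have : (fun=> c) @ \oo --> (0 : R).
    by apply: cvg0_le s0 => k; rewrite c0 cs.
  by move/(cvg_lim (@Rhausdorff R)); rewrite lim_cst // => ->.
have bPw := bounded_markov_op A action bw.
have bPPw := bounded_markov_op A action bPw.
have subP f h : P (vec_sub f h) = vec_sub (P f) (P h) := iter_markov_op_sub 1 f h.
have Psq f h : bounded_vec f -> bounded_vec h ->
    sqnorm (vec_sub (P f) (P h)) <= sqnorm (vec_sub f h).
  by move=> bf bh; rewrite -subP; apply: sqnorm_markov_op; exact: bounded_vec_sub.
have diff0 n f : (forall k, (k <= n k)%N) -> bounded_vec f ->
    sqnorm (vec_sub (iter (n k) P g) f) @[k --> \oo] --> (0 : R) ->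
    forall i j, mean (fun x => (f i x - f j x) ^+ 2) = 0.
  move=> nk bf uf i j.
  have cf l : mean (fun x => (iter (n k) P g l x - f l x) ^+ 2) @[k --> \oo] --> (0 : R).
    have := cvg0_comb2 (q 0 l)^-1 0 uf uf.
    under eq_fun do rewrite mul0r addr0; apply: cvg0_le => k.
    by rewrite mean_le_sqnorm ?andbT //; apply: mean_ge0 => x; exact: sqr_ge0.
  have cc : mean (fun x => (iter (n k) P g i x - iter (n k) P g j x) ^+ 2)
      @[k --> \oo] --> (0 : R).
    apply: (cvg_comp n (fun k => mean (fun x => (iter k P g i x - iter k P g j x) ^+ 2)));
      last exact: letter_diff_cvg0.
    apply/cvgnyPge => K; near=> k; apply: leq_trans (nk k); near: k; exact: nbhs_infty_ge.
  apply: (null _ _ _ _ (cvg0_comb2 2 2 (cf i) (cvg0_comb2 2 2 cc (cf j)))).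
    by apply: mean_ge0 => x; exact: sqr_ge0.
  move=> k /=; have bc : bounded_vec (iter (n k) P g) by exact: bP.
  apply: le_trans (mean_sq_triangle (bf i) (bc i) (bf j)) _.
  rewrite mean_sq_sym lerD2l ler_wpM2l //.
  exact: mean_sq_triangle (bc i) (bc j) (bf j).
exists w; split=> //.
- have uw1 : sqnorm (vec_sub (u k.+1) w) @[k --> \oo] --> (0 : R).
    by rewrite (cvg_shiftS (fun k => sqnorm (vec_sub (u k) w))).
  apply: (null _ _ _ _ (cvg0_comb2 2 2 uw uw1)).
    exact: (sqnorm_ge0 nu chain).
  move=> k /=; have := sqnorm_sub_triangle bPPw (bP (k.+1).*2.+1) bw.
  move=> /le_trans; apply; rewrite lerD2r ler_wpM2l // sqnorm_sub_sym.
  apply: le_trans (Psq _ _ (bounded_markov_op A action (bP k.*2.+1)) bPw) _.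
  exact: Psq (bP k.*2.+1) bw.
- by apply: (diff0 (fun k => k.*2.+1)) => // k; rewrite -addnn -addnS leq_addr.
- apply: (diff0 (fun k => k.*2.+2)) => //.
    by move=> k; rewrite -addnn -!addnS leq_addr.
  apply: cvg0_le uw => k; rewrite (sqnorm_ge0 nu chain) andTb.
  exact: Psq (bP k.*2.+1) bw.
Unshelve. all: by end_near. Qed.

End Orbit.
End L2Convergence.

(** * Almost everywhere convergence for bounded functions *)
Section AlmostEverywhere.
Variables (R : realType) (d : measure_display) (X : measurableType d).
Variable nu : probability X R.

Lemma ae_comp (Q : X -> Prop) (t : X -> X) : measurable_fun setT t ->
  (forall B, measurable B -> nu (t @^-1` B) = nu B) ->
  {ae nu, forall x, Q x} -> {ae nu, forall x, Q (t x)}.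
Proof.
move=> mt pt [N [mN N0 QN]]; exists (t @^-1` N); split.
- by rewrite -[X in measurable X]setTI; exact: mt.
- by rewrite pt.
- by move=> x; exact: QN.
Qed.

(** For fixed r, the intersection of the sets E obtained for e = 1, 1/2, 1/3, ..
    is a null set. *)
Lemma ae_small_exceptions (Q : nat -> X -> Prop) :
  (forall r (e : R), 0 < e -> exists E, [/\ measurable E, (nu E <= e%:E)%E &
    {ae nu, forall x, ~ E x -> Q r x}]) ->
  {ae nu, forall x r, Q r x}.
Proof.
move=> small; apply: ae_foralln => r.
have /choice[E HE] : forall n : nat, exists E, [/\ measurable E,
    (nu E <= (n.+1%:R^-1)%:E)%E & {ae nu, forall x, ~ E x -> Q r x}].
  by move=> n; apply: small; rewrite invr_gt0.
have mE n : measurable (E n) by case: (HE n).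
have I0 : {ae nu, forall x, ~ (\bigcap_n E n) x}.
  have mI : measurable (\bigcap_n E n) by exact: bigcap_measurable.
  exists (\bigcap_n E n); split => //; last by move=> x /contrapT.
  apply/eqP; rewrite eq_le measure_ge0 andbT; apply/lee_addgt0Pr => e e0.
  have [n ne] : exists n, n.+1%:R^-1 < e.
    by have [n] := ltr_add_invr e0; rewrite add0r; exists n.
  rewrite add0e; apply: (@le_trans _ _ (nu (E n))).
    by apply: le_measure; rewrite ?inE //; exact: bigcap_inf.
  by case: (HE n) => _ /le_trans + _; apply; rewrite lee_fin ltW.
have QE : {ae nu, forall x n, ~ E n x -> Q r x}.
  by apply: ae_foralln => n; case: (HE n).
apply: filterS2 I0 QE => x nI HQ; apply: contrapT => nQ; apply: nI => n _.
by apply: contrapT => /HQ.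
Qed.

(** Fatou's lemma. *)
Lemma integral_limit_le (f : nat -> X -> R) (g : X -> R) (c : \bar R) :
  (forall n, measurable_fun setT (f n)) -> (forall n x, 0 <= f n x) ->
  measurable_fun setT g -> {ae nu, forall x, f^~ x @ \oo --> g x} ->
  (forall n, \int[nu]_x (f n x)%:E <= c)%E -> (\int[nu]_x (g x)%:E <= c)%E.
Proof.
move=> mf f0 mg fg fc.
have mF n : measurable_fun setT (fun x => (f n x)%:E) by apply/measurable_EFinP; exact: mf.
have mG : measurable_fun setT (fun x => (g x)%:E) by apply/measurable_EFinP.
have mL : measurable_fun setT (fun x => limn_einf (fun n => (f n x)%:E)).
  apply: (measurableT_comp (f := -%E)) => //.
  apply: (measurable_fun_limn_esup (f := fun n x => (- (f n x)%:E)%E)) => n.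
  exact: measurableT_comp.
have -> : (\int[nu]_x (g x)%:E = \int[nu]_x (limn_einf (fun n => (f n x)%:E)))%E.
  apply: ae_eq_integral => //; apply: filterS fg => x fgx _ /=.
  have fE : (f n x)%:E @[n --> \oo] --> (g x)%:E.
    by apply: cvg_EFin fgx; exact: nearW.
  rewrite is_cvg_limn_einfE; last by apply/cvg_ex; exists (g x)%:E.
  by apply/esym/cvg_lim.
apply: le_trans (fatou _ measurableT mF _) _.
  by move=> n x _; rewrite lee_fin.
rewrite limn_einf_lim; apply: lime_le; first exact: is_cvg_einfs.
apply: nearW => n; apply: le_trans (fc n); apply: ereal_inf_lbound.
by exists n => /=.
Qed.

End AlmostEverywhere.

Section BoundedPointwise.
Variables (R : realType) (d : measure_display) (X : measurableType d).
Variables (nu : probability X R) (m : nat) (tau : letter m -> X -> X).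
Variables (A : 'M[R]_(m + m)) (q : 'rV[R]_(m + m)).
Hypothesis action : letter_action nu tau.
Hypothesis chain : reversible_chain A q.
Hypothesis turn_sq_connected : forall S : letter m -> letter m -> Prop,
  (forall i j k, S i j -> S j k -> S i k) ->
  (forall i j, 0 < turn_sq A i j -> S i j) -> forall i j, S i j.
Variables (n : nat) (eps : R).
Hypothesis n_odd : odd n.
Hypothesis eps_gt0 : 0 < eps.
Hypothesis turn_eps : forall f : letter m -> X -> R, (forall i y, 0 <= f i y) ->
  forall i y, eps * f i y <= iter n (turn_op A) f i y.
Implicit Types (f g h : letter m -> X -> R).

Local Notation P := (markov_op tau A).
Local Notation sqnorm := (sqnorm nu q).

Let A_ge0 := chain_ge0 chain.
Let A_sum1 := chain_sum1 chain.
Let q_ge0 i : 0 <= q 0 i. Proof. exact: ltW (chain_law_gt0 chain i). Qed.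

Lemma letter_avg_const (c : R) f x : (forall i, f i x = c) -> letter_avg q f x = c.
Proof.
move=> fc; rewrite /letter_avg; under eq_bigr do rewrite fc.
by rewrite -mulr_suml (chain_law_sum1 chain) mul1r.
Qed.

Lemma letter_avg_sub f g x :
  letter_avg q (vec_sub f g) x = letter_avg q f x - letter_avg q g x.
Proof. by rewrite /letter_avg -sumrB; apply: eq_bigr => i _; rewrite mulrBr. Qed.

Lemma normr_letter_avg_iter k f x :
  `|letter_avg q (iter k P f) x| <= letter_avg q (iter k P (fun i x => `|f i x|)) x.
Proof.
have normP i y : `|iter k P f i y| <= iter k P (fun i x => `|f i x|) i y.
  elim: k i y => //= k IHk i y; rewrite (le_trans (ler_norm_sum _ _ _)) //.
  by apply: ler_sum => j _; rewrite normrM ger0_norm // ler_wpM2l.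
rewrite (le_trans (ler_norm_sum _ _ _)) //; apply: ler_sum => i _.
by rewrite normrM ger0_norm // ler_wpM2l.
Qed.

Lemma sqnorm_eq0_ae f : bounded_vec f -> sqnorm f = 0 ->
  {ae nu, forall x i, f i x = 0}.
Proof.
move=> bf f0.
have fi i : {ae nu, forall x, f i x = 0}.
  apply: mean_sq_eq0_ae => //; apply/eqP.
  have mge0 j : 0 <= mean nu (fun x => f j x * f j x).
    by apply: mean_ge0 => x; rewrite -expr2 sqr_ge0.
  have /psumr_eq0P := f0.
  move=> /(_ (fun j _ => mulr_ge0 (q_ge0 j) (mge0 j))) /(_ i isT) /eqP.
  by rewrite mulf_eq0 gt_eqF ?(chain_law_gt0 chain).
by apply: filter_forall.
Qed.

(** The averages differ from the limit in mean square by a quantity that tends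
    to 0, and the maximal inequality turns the smallness of P^(2K+1) g - w for
    one K into the smallness of all later differences outside a small set. *)
Theorem bounded_ae_convergence g : bounded_vec g -> exists psi, [/\
  bounded_measurable psi,
  (forall i j, {ae nu, forall x, psi (tau i (tau j x)) = psi x}) &
  {ae nu, forall x, letter_avg q (iter k.*2.+1 P g) x @[k --> \oo] --> psi x}].
Proof.
move=> bg; have [w [bw uw PPw wij Pwij]] := bounded_orbit_limit action chain turn_sq_connected bg.
have bPw := bounded_markov_op A action bw.
have bPPw := bounded_markov_op A action bPw.
have b0 : bounded_measurable (letter_avg q w).
  by apply: bounded_measurable_sum => i; exact: bounded_measurableZ.
have w_ae i j : {ae nu, forall x, w i x = w j x}.
  have := mean_sq_eq0_ae (bounded_measurableB (bw i) (bw j)) (wij i j).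
  by apply: filterS => x /eqP; rewrite subr_eq0 => /eqP.
have Pw_ae i j : {ae nu, forall x, P w i x = P w j x}.
  have := mean_sq_eq0_ae (bounded_measurableB (bPw i) (bPw j)) (Pwij i j).
  by apply: filterS => x /eqP; rewrite subr_eq0 => /eqP.
have psi_ae i : {ae nu, forall x, w i x = letter_avg q w x}.
  have : {ae nu, forall x j, w j x = w i x} by apply: filter_forall.
  by apply: filterS => x wx; rewrite (letter_avg_const wx).
exists (letter_avg q w); split => //.
- move=> i j.
  have mt := letter_action_measurable action; have pt := letter_action_preserving action.
  (* The k-th coordinate of P w is psi \o tau k, and these coordinates all
     agree: psi \o tau i = psi \o tau (linv j), to be composed with tau j. *)
  have Pw_psi k : {ae nu, forall x, P w k x = letter_avg q w (tau k x)}.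
    have H : {ae nu, forall x j, w j (tau k x) = letter_avg q w (tau k x)}.
      apply: (ae_comp (Q := fun y => forall j, w j y = letter_avg q w y) (mt k) (pt k)).
      exact: filter_forall.
    apply: filterS H => x wx; rewrite /markov_op; under eq_bigr do rewrite wx.
    by rewrite -mulr_suml A_sum1 mul1r.
  have H : {ae nu, forall y, letter_avg q w (tau i y) = letter_avg q w (tau (linv j) y)}.
    by apply: filterS3 (Pw_psi i) (Pw_psi (linv j)) (Pw_ae i (linv j)) => x <- <-.
  have := ae_comp (mt j) (pt j) H.
  by apply: filterS => x ->; rewrite (letter_actionK action).
- have [C C0 HC] := weak_maximal_ineq action chain n_odd eps_gt0 turn_eps (ltr1n R 2).
  pose Q (r : nat) x := exists K, forall k, (K <= k)%N ->
    `|letter_avg q (iter k.*2.+1 P g) x - letter_avg q w x| <= r.+1%:R^-1.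
  suff : {ae nu, forall x r, Q r x}.
    apply: filterS => x Qx; apply/cvgrPdist_le => e e0.
    have [r re] := ltr_add_invr e0; have [K HK] := Qx r.
    near=> k; rewrite distrC; apply: le_trans (HK k _) _.
      by near: k; exact: nbhs_infty_ge.
    by rewrite add0r in re; exact: ltW.
  apply: ae_small_exceptions => r e e0; pose lam : R := r.+1%:R^-1.
  have lam0 : 0 < lam by rewrite invr_gt0.
  have c0 : 0 < (C + 1) / lam `^ 2 by rewrite divr_gt0 ?powR_gt0 // ltr_wpDl.
  have /cvgrPdist_le/(_ _ (divr_gt0 e0 c0))[K _ /(_ K (leqnn K))/=] := uw.
  rewrite sub0r normrN ger0_norm ?(sqnorm_ge0 nu chain) // => small.
  set u := iter K.*2.+1 P g in small *.
  have bu : bounded_vec u by exact: (bounded_iter_markov_op A action).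
  have buw := bounded_vec_sub bu bw.
  set h := P (vec_sub u w).
  have bh : bounded_vec h by exact: (bounded_markov_op A action buw).
  have mh i : measurable_fun setT (fun x => `|h i x|).
    by apply: measurableT_comp => //; case: (bh i).
  exists [set x | exists a, lam < letter_avg q (iter a.*2.+1 P (fun i x => `|h i x|)) x].
  split.
  + exact: (measurable_maximal_set A q action).
  + apply: le_trans (HC _ _ mh _ lam0) _; first by move=> i x; exact: normr_ge0.
    have -> : (\int[nu]_x (letter_avg q (fun i x => (`|h i x| `^ 2)%R) x)%:E)%E =
        (sqnorm h)%:E.
      rewrite /sqnorm /dot.
      have bsq i : bounded_measurable (fun x => h i x * h i x).
        exact: bounded_measurableM.
      transitivity (mean nu (fun x => \sum_i q 0 i * (h i x * h i x)))%:E.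
        rewrite meanE; last by apply: bounded_measurable_sum => i; exact: bounded_measurableZ.
        apply: eq_integral => x _; congr EFin; apply: eq_bigr => i _.
        by rewrite powR_mulrn // real_normK ?num_real // expr2.
      rewrite mean_sum; last by move=> i; exact: bounded_measurableZ.
      by congr EFin; apply: eq_bigr => i _; rewrite meanZ.
    rewrite -EFinM lee_fin.
    have hs : sqnorm h <= e / ((C + 1) / lam `^ 2).
      exact: le_trans (sqnorm_markov_op action chain buw) small.
    apply: (@le_trans _ _ ((C + 1) / lam `^ 2 * sqnorm h)).
      rewrite ler_wpM2r ?(sqnorm_ge0 nu chain) // ler_wpM2r ?invr_ge0 ?powR_ge0 //.
      by rewrite lerDl.
    by rewrite mulrC -ler_pdivlMr.
  + have iter0 j : {ae nu, forall x i, iter j.*2.+2 P w i x = w i x}.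
      have : sqnorm (vec_sub (iter j.*2.+2 P w) w) = 0.
        elim: j => [|j IHj] //.
        apply/eqP; rewrite eq_le (sqnorm_ge0 nu chain) andbT.
        have b2 : bounded_vec (iter j.+1.*2.+2 P w) by exact: (bounded_iter_markov_op A action).
        apply: le_trans (sqnorm_sub_triangle nu chain b2 bPPw bw) _.
        have bj : bounded_vec (iter j.*2.+2 P w) by exact: (bounded_iter_markov_op A action).
        rewrite PPw mulr0 addr0.
        have -> : vec_sub (iter j.+1.*2.+2 P w) (P (P w)) =
            iter 2 P (vec_sub (iter j.*2.+2 P w) w).
          by rewrite iter_markov_op_sub.
        rewrite mulr_ge0_le0 // -IHj.
        exact: (sqnorm_iter_markov_op action chain 2 (bounded_vec_sub bj bw)).
      move=> /sqnorm_eq0_ae H; apply: filterS (H _) => [x Hx i|].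
        by apply/eqP; rewrite -subr_eq0; apply/eqP; exact: Hx.
      apply: bounded_vec_sub => //; exact: (bounded_iter_markov_op A action).
    have iter_ae : {ae nu, forall x j i, iter j.*2.+2 P w i x = w i x} by exact: ae_foralln.
    apply: filterS iter_ae => x wx notE; exists K.+1 => k Kk.
    pose j := (k - K.+1)%N.
    (* One of the 2j + 2 powers of P goes into h, since the maximal inequality is
       about odd powers. *)
    have kE : k.*2.+1 = (j.*2.+2 + K.*2.+1)%N.
      by rewrite -[in LHS](subnK Kk) -/j doubleD doubleS !addSn !addnS.
    have -> : letter_avg q w x = letter_avg q (iter j.*2.+2 P w) x.
      by apply: eq_bigr => i _; rewrite wx.
    rewrite kE iterD -/u -letter_avg_sub -iter_markov_op_sub iterSr -/h.
    apply: le_trans (normr_letter_avg_iter _ _ _) _.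
    by rewrite leNgt; apply/negP => ?; apply: notE; exists j.
Unshelve. all: by end_near. Qed.

End BoundedPointwise.

(** * Powers of the L^p norm, truncation *)
Section LpIntegral.
Variables (R : realType) (d : measure_display) (X : measurableType d).
Variables (nu : probability X R) (p : R).
Hypothesis p_gt1 : 1 < p.
Let p_gt0 : 0 < p. Proof. exact: lt_trans p_gt1. Qed.
Implicit Types f g h : X -> R.

Definition powint f : \bar R := (\int[nu]_x (`|f x| `^ p)%:E)%E.

Lemma powint_ge0 f : (0 <= powint f)%E.
Proof. by apply: integral_ge0 => x _; rewrite lee_fin powR_ge0. Qed.

Lemma measurable_norm_pow f : measurable_fun setT f ->
  measurable_fun setT (fun x => `|f x| `^ p).
Proof. by move=> mf; apply: measurable_pow; exact: measurableT_comp. Qed.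

Lemma powint_add3 f g h : measurable_fun setT f -> measurable_fun setT g ->
  measurable_fun setT h -> (powint (fun x => f x + g x + h x)%R <=
  (3 `^ p)%:E * (powint f + powint g + powint h))%E.
Proof.
move=> mf mg mh.
have m3 : measurable_fun setT (fun x => f x + g x + h x).
  by do 2!apply: measurable_funD => //.
have F f' : measurable_fun setT f' -> measurable_fun setT (fun x => (`|f' x| `^ p)%:E).
  by move=> mf'; apply/measurable_EFinP; exact: measurable_norm_pow.
have G0 (f' : X -> R) x : (0 <= (`|f' x| `^ p)%:E)%E by rewrite lee_fin powR_ge0.
have F2 := emeasurable_funD (F _ mf) (F _ mg).
rewrite /powint -ge0_integralD //; [|exact: F..].
rewrite -ge0_integralD //; [|by move=> x _; rewrite adde_ge0|exact: F].
rewrite -ge0_integralZl_EFin ?powR_ge0 //; last 2 first.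
- by move=> x _; rewrite !adde_ge0.
- by apply: emeasurable_funD => //; exact: F.
apply: ge0_le_integral => //.
- exact: F.
- by apply: measurable_funeM; apply: emeasurable_funD => //; exact: F.
- move=> x _; rewrite -!EFinD -EFinM lee_fin.
  apply: le_trans (powR_add3_le p_gt1 _ _ _) => //.
  apply: ge0_ler_powR; rewrite ?nnegrE ?(ltW p_gt0) ?addr_ge0 //.
  by rewrite (le_trans (ler_normD _ _)) // lerD2r ler_normD.
Qed.

(** At l = 0 the logarithm in the definition of the power is of no help. *)
Lemma cvg_norm_pow (u : nat -> R) (l : R) : u @ \oo --> l ->
  `|u k| `^ p @[k --> \oo] --> `|l| `^ p.
Proof.
move=> /cvg_norm ul; have := normr_ge0 l; rewrite le_eqVlt => /predU1P[l0|l0].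
  rewrite -l0 powR0 ?gt_eqF //; rewrite -l0 in ul; apply/cvgrPdist_le => e e0.
  have d0 : 0 < e `^ p^-1 by exact: powR_gt0.
  move/cvgrPdist_le: ul => /(_ _ d0); apply: filterS => k.
  rewrite sub0r normrN normr_id => ud.
  rewrite sub0r normrN [leLHS]ger0_norm ?powR_ge0 //.
  have -> : e = (e `^ p^-1) `^ p by rewrite -powRrM mulVf ?gt_eqF // powRr1 // ltW.
  by apply: ge0_ler_powR; rewrite ?nnegrE ?powR_ge0 // ltW.
have -> : `|l| `^ p = expR (p * ln `|l|) by rewrite /powR gt_eqF.
have lnu : p * ln `|u k| @[k --> \oo] --> p * ln `|l|.
  by apply: cvgMr; exact: (cvg_comp _ _ ul (continuous_ln l0)).
have expu := cvg_comp _ _ lnu (@continuous_expR R (p * ln `|l|)).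
apply: cvg_trans expu; apply: near_eq_cvg; near=> k.
rewrite /powR /= gt_eqF //; near: k; exact: cvgr_gt ul _ l0.
Unshelve. all: by end_near. Qed.

Lemma powint_limit_le (f : nat -> X -> R) g (c : \bar R) :
  (forall k, measurable_fun setT (f k)) -> measurable_fun setT g ->
  {ae nu, forall x, f^~ x @ \oo --> g x} -> (forall k, powint (f k) <= c)%E ->
  (powint g <= c)%E.
Proof.
move=> mf mg fg; apply: integral_limit_le.
- by move=> k; exact: measurable_norm_pow.
- by move=> k x; exact: powR_ge0.
- exact: measurable_norm_pow.
- by apply: filterS fg => x; exact: cvg_norm_pow.
Qed.

Lemma powint_sub_sym f g :
  powint (fun x => f x - g x) = powint (fun x => g x - f x).
Proof. by apply: eq_integral => x _; rewrite distrC. Qed.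

Lemma powint_bounded_cvg0 (f : nat -> X -> R) g M :
  (forall k, measurable_fun setT (f k)) -> measurable_fun setT g ->
  (forall k x, `|f k x - g x| <= M) -> {ae nu, forall x, f^~ x @ \oo --> g x} ->
  powint (fun x => f k x - g x) @[k --> \oo] --> 0%E.
Proof.
move=> mf mg fM fg.
have F f' : measurable_fun setT f' -> measurable_fun setT (fun x => (`|f' x| `^ p)%:E).
  by move=> mf'; apply/measurable_EFinP; exact: measurable_norm_pow.
have [|||||_ _] := @dominated_convergence _ X R nu setT measurableT
  (fun k x => (`|f k x - g x| `^ p)%:E) (cst 0%E) (cst (M `^ p)%:E).
- by move=> k; apply: F; exact: measurable_funB.
- exact: measurable_cst.
- apply: filterS fg => x fgx _; apply: cvg_EFin; first exact: nearW.
  have : f k x - g x @[k --> \oo] --> g x - g x by apply: cvgB => //; exact: cvg_cst.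
  by rewrite subrr => /cvg_norm_pow; rewrite normr0 powR0 // gt_eqF.
- exact: finite_measure_integrable_cst.
- apply: aeW => x k _; rewrite gee0_abs ?lee_fin ?powR_ge0 //.
  apply: ge0_ler_powR; rewrite ?nnegrE ?(ltW p_gt0) //.
  exact: le_trans (fM k x).
by rewrite integral0.
Qed.

Lemma powint_eq0_ae f : measurable_fun setT f -> powint f = 0%E ->
  {ae nu, forall x, f x = 0}.
Proof.
move=> mf f0.
have : (\int[nu]_x `|(`|f x| `^ p)%:E| = 0)%E.
  by rewrite -f0; apply: eq_integral => x _; rewrite gee0_abs // lee_fin powR_ge0.
move/ae_eq_integral_abs => /(_ measurableT) H.
have /H : measurable_fun setT (fun x => (`|f x| `^ p)%:E).
  by apply/measurable_EFinP; exact: measurable_norm_pow.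
apply: filterS => x /(_ I) /= -[] /powR_eq0_eq0 /eqP; rewrite normr_eq0 => /eqP.
exact.
Qed.

Definition truncation (K : nat) f x : R := if `|f x| <= K%:R then f x else 0.

Lemma measurable_truncation K f : measurable_fun setT f ->
  measurable_fun setT (truncation K f).
Proof.
move=> mf; apply: measurable_fun_ifT => //.
by apply: measurable_fun_ler => //; exact: measurableT_comp.
Qed.

Lemma bounded_truncation K f : measurable_fun setT f ->
  bounded_measurable (truncation K f).
Proof.
move=> mf; split; first exact: measurable_truncation.
by exists K%:R => x; rewrite /truncation; case: ifP; rewrite ?normr0.
Qed.

Lemma powint_truncation f (e : R) : measurable_fun setT f -> (powint f < +oo)%E ->
  0 < e -> exists K, (powint (fun x => f x - truncation K f x)%R <= e%:E)%E.
Proof.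
move=> mf fi e0.
have F f' : measurable_fun setT f' -> measurable_fun setT (fun x => (`|f' x| `^ p)%:E).
  by move=> mf'; apply/measurable_EFinP; exact: measurable_norm_pow.
have mt K : measurable_fun setT (fun x => f x - truncation K f x).
  by apply: measurable_funB => //; exact: measurable_truncation.
have [|||||_ _ dc] := @dominated_convergence _ X R nu setT measurableT
  (fun K x => (`|f x - truncation K f x| `^ p)%:E) (cst 0%E) (fun x => (`|f x| `^ p)%:E).
- by move=> K; exact: F.
- exact: measurable_cst.
- apply: aeW => x _; apply: cvg_near_cst; near=> K.
  rewrite /truncation ifT; first by rewrite subrr normr0 powR0 // gt_eqF.
  by near: K; exact: nbhs_infty_ger.
- apply/integrableP; split; first exact: F.
  by under eq_integral => x _ do rewrite gee0_abs ?lee_fin ?powR_ge0 //.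
- apply: aeW => x K _; rewrite gee0_abs ?lee_fin ?powR_ge0 //.
  apply: ge0_ler_powR; rewrite ?nnegrE ?(ltW p_gt0) //.
  by rewrite /truncation; case: ifP; rewrite ?subrr ?subr0 ?normr0.
move: dc; rewrite integral0 => /fine_cvgP[]; move=> [K1 _ HK1] /cvgrPdist_le/(_ _ e0)[K2 _ HK2].
have /= fin := HK1 (maxn K1 K2) (leq_maxl _ _).
have /= := HK2 (maxn K1 K2) (leq_maxr _ _).
rewrite sub0r normrN ger0_norm ?fine_ge0 ?integral_ge0 // => le_e.
exists (maxn K1 K2); by rewrite /powint -(fineK fin) lee_fin.
Unshelve. all: by end_near. Qed.

End LpIntegral.

(** * Convergence of the even averages in L^p *)
Lemma ereal_cvg0P (R : realType) (u : nat -> \bar R) : (forall k, (0 <= u k)%E) ->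
  u @ \oo --> 0%E <-> forall e : R, 0 < e -> \forall k \near \oo, (u k <= e%:E)%E.
Proof.
move=> u0; split=> [/fine_cvgP[ufin u_0] e e0|usmall].
  move/cvgrPdist_le: u_0 => /(_ _ e0) u_e; near=> k.
  have fk : u k \is a fin_num by near: k.
  rewrite -(fineK fk) lee_fin.
  have : `|0 - fine (u k)| <= e by near: k.
  by rewrite sub0r normrN ger0_norm // fine_ge0.
have ufin : \forall k \near \oo, u k \is a fin_num.
  apply: filterS (usmall 1 ltr01) => k uk1.
  by rewrite ge0_fin_numE // (le_lt_trans uk1) // ltry.
apply/fine_cvgP; split=> //; apply/cvgrPdist_le => e e0; near=> k.
have fk : u k \is a fin_num by near: k.
rewrite /= sub0r normrN ger0_norm ?fine_ge0 // -lee_fin fineK //.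
by near: k; exact: usmall.
Unshelve. all: by end_near. Qed.

Section LpConvergence.
Variables (R : realType) (d : measure_display) (X : measurableType d).
Variables (nu : probability X R) (m : nat) (tau : letter m -> X -> X).
Variables (A : 'M[R]_(m + m)) (q : 'rV[R]_(m + m)).
Hypothesis action : letter_action nu tau.
Hypothesis chain : reversible_chain A q.
Hypothesis turn_sq_connected : forall S : letter m -> letter m -> Prop,
  (forall i j k, S i j -> S j k -> S i k) ->
  (forall i j, 0 < turn_sq A i j -> S i j) -> forall i j, S i j.
Variables (n : nat) (eps : R).
Hypothesis n_odd : odd n.
Hypothesis eps_gt0 : 0 < eps.
Hypothesis turn_eps : forall f : letter m -> X -> R, (forall i y, 0 <= f i y) ->
  forall i y, eps * f i y <= iter n (turn_op A) f i y.
Variable p : R.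
Hypothesis p_gt1 : 1 < p.
Let p_gt0 : 0 < p. Proof. exact: lt_trans p_gt1. Qed.
Implicit Types phi psi : X -> R.

Local Notation P := (markov_op tau A).
Local Notation powint := (powint nu p).

Let A_ge0 := chain_ge0 chain.
Let A_sum1 := chain_sum1 chain.
Let q_ge0 i : 0 <= q 0 i. Proof. exact: ltW (chain_law_gt0 chain i). Qed.

(** The walk starts with the vector all of whose coordinates are phi. Its first
    step is kept apart because the maximal inequality is about odd powers of P,
    and an even number of steps is wanted. *)
Definition even_average (phi : X -> R) k : X -> R :=
  letter_avg q (iter k.*2.+1 P (P (fun=> phi))).

Local Notation avg := even_average.

Lemma markov_op_const phi i x : P (fun=> phi) i x = phi (tau i x).
Proof. by rewrite /markov_op -mulr_suml A_sum1 mul1r. Qed.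

Lemma measurable_markov_const phi : measurable_fun setT phi ->
  forall i, measurable_fun setT (P (fun=> phi) i).
Proof. by move=> mphi; exact: (measurable_markov_op A action (fun=> mphi)). Qed.

Lemma measurable_even_average phi k : measurable_fun setT phi ->
  measurable_fun setT (avg phi k).
Proof.
move=> mphi; apply: measurable_letter_avg.
exact: (measurable_iter_markov_op A action _ (measurable_markov_const mphi)).
Qed.

Lemma even_average_sub phi psi k x :
  avg (fun x => phi x - psi x) k x = avg phi k x - avg psi k x.
Proof.
rewrite /even_average -letter_avg_sub -iter_markov_op_sub; congr letter_avg.
congr iter; apply/funext => i; apply/funext => y.
by rewrite /vec_sub !markov_op_const.
Qed.

Lemma integral_markov_const phi : measurable_fun setT phi -> (forall x, 0 <= phi x) ->
  (\int[nu]_x (letter_avg q (P (fun=> phi)) x)%:E = \int[nu]_x (phi x)%:E)%E.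
Proof.
move=> mphi phi0; rewrite (integral_markov_op action chain) //.
apply: eq_integral => x _; congr EFin; exact: (letter_avg_const chain).
Qed.

(** Jensen's inequality at every step, and the invariance of the integral. *)
Lemma powint_even_average phi k : measurable_fun setT phi ->
  (powint (avg phi k) <= powint phi)%E.
Proof.
move=> mphi; pose psi x := `|phi x| `^ p.
have mpsi : measurable_fun setT psi by exact: (measurable_norm_pow p mphi).
have psi0 x : 0 <= psi x by exact: powR_ge0.
have mPpsi := measurable_markov_const mpsi.
have Ppsi0 : forall i x, 0 <= P (fun=> psi) i x by exact: (markov_op_ge0 _ chain).
rewrite {2}/powint -(integral_markov_const mpsi psi0).
rewrite -(integral_iter_markov_op action chain k.*2.+1 mPpsi Ppsi0).
have m1 : measurable_fun setT (fun x => (`|avg phi k x| `^ p)%:E).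
  apply/measurable_EFinP; apply: measurable_norm_pow.
  exact: (measurable_even_average k mphi).
have m2 := measurable_letter_avg q (measurable_iter_markov_op A action k.*2.+1 mPpsi).
have a0 x : (0 <= (`|avg phi k x| `^ p)%:E)%E by rewrite lee_fin powR_ge0.
apply: ge0_le_integral => //; first exact/measurable_EFinP.
move=> x _; rewrite lee_fin /even_average.
  have pow_iter l i y : `|iter l P (P (fun=> phi)) i y| `^ p <= iter l P (P (fun=> psi)) i y.
    elim: l i y => [|l IHl] i y; first by rewrite /= !markov_op_const.
    rewrite !iterS; set f := iter l P _.
    apply: (@le_trans _ _ ((\sum_j A i j * `|f j (tau i y)|) `^ p)).
      apply: ge0_ler_powR; rewrite ?nnegrE ?(ltW p_gt0) //.
        by apply: sumr_ge0 => j _; rewrite mulr_ge0.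
      rewrite (le_trans (ler_norm_sum _ _ _)) //; apply: ler_sum => j _.
      by rewrite normrM ger0_norm.
    apply: le_trans (powR_average_le p_gt1 _ _ _) _ => //.
    by apply: ler_sum => j _; rewrite ler_wpM2l.
  set f := iter _ P _.
  apply: (@le_trans _ _ ((\sum_i q 0 i * `|f i x|) `^ p)).
    apply: ge0_ler_powR; rewrite ?nnegrE ?(ltW p_gt0) //.
      by apply: sumr_ge0 => j _; rewrite mulr_ge0.
    rewrite (le_trans (ler_norm_sum _ _ _)) //; apply: ler_sum => j _.
    by rewrite normrM ger0_norm.
  apply: le_trans (powR_average_le p_gt1 _ _ _) _ => //.
    exact: (chain_law_sum1 chain).
  by apply: ler_sum => i _; rewrite ler_wpM2l //; exact: pow_iter.
Qed.

(** Continuity at 0 in measure of the maximal function, uniformly for phi in a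
    small ball of L^p. *)
Lemma even_average_maximal (lam e : R) : 0 < lam -> 0 < e ->
  exists2 c : R, 0 < c & forall phi, measurable_fun setT phi ->
  (powint phi <= c%:E)%E -> exists E, [/\ measurable E, (nu E <= e%:E)%E &
    forall x, ~ E x -> forall k, `|avg phi k x| <= lam].
Proof.
move=> lam0 e0.
have [C C0 HC] := weak_maximal_ineq action chain n_odd eps_gt0 turn_eps p_gt1.
have c0 : 0 < (C + 1) / lam `^ p by rewrite divr_gt0 ?powR_gt0 // ltr_wpDl.
exists (e / ((C + 1) / lam `^ p)); first by rewrite divr_gt0.
move=> phi mphi phi_small.
pose h i x := `|P (fun=> phi) i x|.
have mh i : measurable_fun setT (h i).
  by apply: measurableT_comp => //; exact: measurable_markov_const.
exists [set x | exists a, lam < letter_avg q (iter a.*2.+1 P h) x]; split.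
- exact: (measurable_maximal_set A q action).
- apply: le_trans (HC _ _ mh _ lam0) _; first by move=> i x; exact: normr_ge0.
  pose psi x := `|phi x| `^ p.
  have -> : (\int[nu]_x (letter_avg q (fun i x => (h i x `^ p)%R) x)%:E)%E = powint phi.
    transitivity (\int[nu]_x (letter_avg q (P (fun=> psi)) x)%:E)%E.
      apply: eq_integral => x _; congr EFin; apply: eq_bigr => i _.
      by rewrite /h !markov_op_const.
    apply: integral_markov_const; last by move=> x; exact: powR_ge0.
    exact: (measurable_norm_pow p mphi).
  apply: (@le_trans _ _ (((C + 1) / lam `^ p)%:E * powint phi)%E).
    apply: lee_wpmul2r; first exact: powint_ge0.
    by rewrite lee_fin ler_wpM2r ?invr_ge0 ?powR_ge0 // lerDl.
  rewrite -lee_pdivlMl //; apply: le_trans phi_small _.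
  by rewrite -EFinM lee_fin mulrC.
- move=> x notE k; apply: le_trans (normr_letter_avg_iter _ chain _ _ _) _.
  by rewrite leNgt; apply/negP => ?; apply: notE; exists k.
Qed.

Section Limit.
Variable phi : X -> R.
Hypothesis mphi : measurable_fun setT phi.
Hypothesis phi_fin : (powint phi < +oo)%E.

Local Notation phiK K := (truncation K phi).

Lemma truncated_limit K : exists psi, [/\ bounded_measurable psi,
  (forall i j, {ae nu, forall x, psi (tau i (tau j x)) = psi x}) &
  {ae nu, forall x, avg (phiK K) k x @[k --> \oo] --> psi x}].
Proof.
apply: (bounded_ae_convergence action chain turn_sq_connected n_odd eps_gt0 turn_eps).
move=> i; rewrite [P _ i](_ : _ = fun x => phiK K (tau i x)).
  apply: bounded_measurable_comp; first exact: (letter_action_measurable action).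
  exact: bounded_truncation.
by apply/funext => x; exact: markov_op_const.
Qed.

(** Outside a small set the averages of phi stay within lam of those of a
    truncation, which converge; four such errors add up to the oscillation. *)
Lemma even_average_ae_cvg : {ae nu, forall x, cvgn (avg phi ^~ x)}.
Proof.
pose Q (r : nat) x := exists K, forall k, (K <= k)%N ->
  `|avg phi k x - avg phi K x| <= r.+1%:R^-1.
suff : {ae nu, forall x r, Q r x}.
  apply: filterS => x Qx; apply/cauchy_cvgP/cauchy_exP => e e0.
  have [r re] := ltr_add_invr e0; have [K HK] := Qx r.
  exists (avg phi K x).
  change (\forall k \near \oo, ball (avg phi K x) e (avg phi k x)).
  near=> k; rewrite -ball_normE /= distrC; apply: le_lt_trans (HK k _) _.
    by near: k; exact: nbhs_infty_ge.
  by rewrite add0r in re.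
apply: ae_small_exceptions => r e e0; pose lam : R := r.+1%:R^-1 / 4.
have lam0 : 0 < lam by rewrite divr_gt0 // invr_gt0.
have [c c0 Hc] := even_average_maximal lam0 e0.
have [K HK] := powint_truncation p_gt1 mphi phi_fin c0.
have mtr := measurable_truncation K mphi.
have [E [mE nuE HE]] := Hc _ (measurable_funB mphi mtr) HK.
exists E; split => //; have [psi [_ _]] := truncated_limit K.
apply: filterS => x /cvgrPdist_le/(_ _ lam0)[N _ HN] notE; exists N => k Nk.
have := HN k Nk; have := HN N (leqnn N); have := HE x notE k; have := HE x notE N.
rewrite !even_average_sub /= !ler_norml -/lam.
have -> : r.+1%:R^-1 = 4 * lam by rewrite /lam mulrC divfK // pnatr_eq0.
lra.
Unshelve. all: by end_near. Qed.

(** Norm convergence and invariance hold for truncations of phi, by dominated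
    convergence. They pass to phi because the averages are contractions, so that
    by Fatou the limits are as close to each other as the functions. *)
Theorem even_average_converges : exists psi, [/\ measurable_fun setT psi,
  (powint psi < +oo)%E,
  (forall i j, {ae nu, forall x, psi (tau i (tau j x)) = psi x}),
  {ae nu, forall x, avg phi k x @[k --> \oo] --> psi x} &
  powint (fun x => avg phi k x - psi x) @[k --> \oo] --> 0%E].
Proof.
(* The upper limit is a measurable choice of the pointwise limit. *)
pose psi x := fine (limn_esup (fun k => (avg phi k x)%:E)).
have mavg := fun k => measurable_even_average k mphi.
have mpsi : measurable_fun setT psi.
  apply: (measurableT_comp (f := fine)) => //.
  apply: (measurable_fun_limn_esup (f := fun k x => (avg phi k x)%:E)) => k.
  by apply/measurable_EFinP.
have psi_lim : {ae nu, forall x, avg phi k x @[k --> \oo] --> psi x}.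
  apply: filterS even_average_ae_cvg => x cv.
  have cvE : (avg phi k x)%:E @[k --> \oo] --> (limn (avg phi ^~ x))%:E.
    by apply: cvg_EFin cv; exact: nearW.
  by rewrite /psi (cvg_limn_einf_sup cvE).2.
have close (e : R) : 0 < e -> exists psiK : X -> R, [/\ measurable_fun setT psiK,
   (forall i j, {ae nu, forall x, psiK (tau i (tau j x)) = psiK x}),
   (powint (fun x => psiK x - psi x)%R <= e%:E)%E &
   exists tr : X -> R, [/\ measurable_fun setT tr,
     (forall k, powint (fun x => avg phi k x - avg tr k x)%R <= e%:E)%E &
     powint (fun x => avg tr k x - psiK x) @[k --> \oo] --> 0%E]].
  move=> e0; have [K HK] := powint_truncation p_gt1 mphi phi_fin e0.
  have mtr := measurable_truncation K mphi.
  have [psiK [bpsiK invK limK]] := truncated_limit K; have [mpsiK [M psiM]] := bpsiK.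
  have mavgK := fun k => measurable_even_average k mtr.
  have avg_close k : (powint (fun x => avg phi k x - avg (phiK K) k x)%R <= e%:E)%E.
    apply: le_trans HK; rewrite (_ : (fun x => _ - _) = avg (fun x => phi x - phiK K x) k).
      by apply: powint_even_average; exact: measurable_funB.
    by apply/funext => x; rewrite even_average_sub.
  exists psiK; split; [exact: mpsiK|exact: invK| |].
    rewrite powint_sub_sym.
    apply: (powint_limit_le p_gt1 _ _ _ avg_close).
    - by move=> k; exact: measurable_funB.
    - exact: measurable_funB.
    - by apply: filterS2 psi_lim limK => x *; exact: cvgB.
  exists (phiK K); split; [exact: mtr|exact: avg_close|].
  have [_ [B trB]] := bounded_truncation K mphi.
  apply: (powint_bounded_cvg0 p_gt1 (M := B + M)) => // k x.
  rewrite (le_trans (ler_normB _ _)) // lerD //.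
  rewrite (le_trans (ler_norm_sum _ _ _)) //.
  rewrite -[leRHS]mul1r -(chain_law_sum1 chain) mulr_suml; apply: ler_sum => i _.
  rewrite normrM ger0_norm // ler_wpM2l // -iterSr.
  by apply: (iter_markov_op_bound tau chain) => _ y; exact: trB.
have three0 : 0 < 3 `^ p * 3 :> R by rewrite mulr_gt0 ?powR_gt0.
have small3 e' (a b c : \bar R) : (a <= (e' / (3 `^ p * 3))%:E)%E ->
    (b <= (e' / (3 `^ p * 3))%:E)%E -> (c <= (e' / (3 `^ p * 3))%:E)%E ->
    ((3 `^ p)%:E * (a + b + c) <= e'%:E)%E.
  move=> ae be ce; apply: (@le_trans _ _ ((3 `^ p)%:E *
      ((e' / (3 `^ p * 3))%:E + (e' / (3 `^ p * 3))%:E + (e' / (3 `^ p * 3))%:E))%E).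
    by apply: lee_wpmul2l; rewrite ?lee_fin ?powR_ge0 // !leeD.
  rewrite -!EFinD -EFinM lee_fin le_eqVlt; apply/orP; left; apply/eqP.
  by field; rewrite gt_eqF // powR_gt0.
exists psi; split; [exact: mpsi| | |exact: psi_lim|].
- apply: le_lt_trans phi_fin; apply: (powint_limit_le p_gt1 mavg mpsi psi_lim) => k.
  exact: powint_even_average.
- move=> i j.
  have mt k := letter_action_measurable action k.
  have mtt : measurable_fun setT (fun x => tau i (tau j x)) by exact: measurableT_comp.
  have mpsit : measurable_fun setT (fun x => psi (tau i (tau j x))).
    exact: measurableT_comp mpsi mtt.
  suff : powint (fun x => psi (tau i (tau j x)) - psi x) = 0%E.
    move=> /(powint_eq0_ae (measurable_funB mpsit mpsi)).
    by apply: filterS => x /eqP; rewrite subr_eq0 => /eqP.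
  apply/eqP; rewrite eq_le powint_ge0 andbT; apply/lee_addgt0Pr => e e0; rewrite add0e.
  have [psiK [mpsiK invK psiKpsi _]] := close _ (divr_gt0 e0 three0).
  have mpsiKt : measurable_fun setT (fun x => psiK (tau i (tau j x))).
    exact: measurableT_comp mpsiK mtt.
  have -> : (fun x => psi (tau i (tau j x)) - psi x) =
      (fun x => (psi (tau i (tau j x)) - psiK (tau i (tau j x))) +
                (psiK x - psi x) + (psiK (tau i (tau j x)) - psiK x)).
    by apply/funext => x; ring.
  apply: le_trans (powint_add3 nu p_gt1 _ _ _) _; [exact: measurable_funB..|].
  have E1 : powint (fun x => psi (tau i (tau j x)) - psiK (tau i (tau j x))) =
      powint (fun x => psiK x - psi x).
    rewrite [RHS]powint_sub_sym; pose D x := `|psi x - psiK x| `^ p.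
    have mD : measurable_fun setT D by apply: measurable_norm_pow; exact: measurable_funB.
    have D0 x : 0 <= D x by exact: powR_ge0.
    have -> : powint (fun x => psi x - psiK x) = (\int[nu]_x (D x)%:E)%E by [].
    rewrite -(integral_action action i mD D0).
    rewrite -(integral_action action j (measurableT_comp mD (mt i))) //.
    by move=> x; exact: D0.
  have E2 : powint (fun x => psiK (tau i (tau j x)) - psiK x) = 0%E.
    have mc : measurable_fun setT (fun x => (`|psiK (tau i (tau j x)) - psiK x| `^ p)%:E).
      by apply/measurable_EFinP; apply: measurable_norm_pow; exact: measurable_funB.
    rewrite -(integral0 nu setT); apply: ae_eq_integral; [by []|exact: mc|by []|].
    apply: filterS (invK i j) => x -> _; rewrite subrr normr0 powR0 //.
    by rewrite gt_eqF.
  rewrite E1 E2; apply: (small3 _ _ _ _ psiKpsi psiKpsi).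
  by rewrite lee_fin ltW // divr_gt0.
- apply/ereal_cvg0P => [k|e e0]; first exact: powint_ge0.
  have [psiK [mpsiK _ psiKpsi [tr [mtr avgtr trK]]]] := close _ (divr_gt0 e0 three0).
  move/ereal_cvg0P : trK => /(_ (fun k => powint_ge0 _ _ _) _ (divr_gt0 e0 three0)).
  apply: filterS => k trKk.
  have mavgtr := measurable_even_average k mtr.
  have -> : (fun x => avg phi k x - psi x) =
      (fun x => (avg phi k x - avg tr k x) + (avg tr k x - psiK x) + (psiK x - psi x)).
    by apply/funext => x; ring.
  apply: le_trans (powint_add3 nu p_gt1 _ _ _) _; [exact: measurable_funB..|].
  exact: small3 (avgtr k) trKk psiKpsi.
Qed.

End Limit.
End LpConvergence.

(** * Odd powers of the turn matrix *)
Lemma sum_gt0_exists (R : realDomainType) (I : Type) (r : seq I) (F : I -> R) :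
  0 < \sum_(i <- r) F i -> exists i, 0 < F i.
Proof.
move=> sum0; apply: contrapT => /forallNP F0; move: sum0.
rewrite ltNge => /negP; apply; apply: sumr_le0 => i _.
by rewrite leNgt; exact/negP.
Qed.

Lemma mulr_gt0_l (R : realDomainType) (a b : R) : 0 <= a -> 0 < a * b -> 0 < a /\ 0 < b.
Proof.
rewrite le_eqVlt => /predU1P[<-|a0]; first by rewrite mul0r ltxx.
by rewrite pmulr_rgt0.
Qed.

Lemma finite_positive_bound (R : realFieldType) (I : finType) (F : I -> R) :
  (forall i, 0 < F i) -> exists2 e, 0 < e & forall i, e <= F i.
Proof.
move=> F0; have V0 i : 0 <= (F i)^-1 by rewrite invr_ge0 ltW.
have s0 : 0 < 1 + \sum_i (F i)^-1 by rewrite ltr_wpDr ?sumr_ge0.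
(* The summand 1 is there for an empty index type. *)
exists (1 + \sum_i (F i)^-1)^-1 => [|i]; first by rewrite invr_gt0.
rewrite -[leRHS]invrK lef_pV2 ?posrE ?invr_gt0 // (bigD1 i) //= addrCA lerDl.
by rewrite addr_ge0 ?sumr_ge0.
Qed.

Section NonnegativeMatrices.
Variables (R : realType) (n : nat).
Implicit Types M : 'M[R]_n.

Lemma mx_exp_ge0 M k i j : (forall i j, 0 <= M i j) -> 0 <= (M ^+ k) i j.
Proof.
move=> M0; elim: k i j => [|k IHk] i j; first by rewrite expr0 mxE ler0n.
by rewrite exprS mxE sumr_ge0 // => l _; rewrite mulr_ge0.
Qed.

Lemma mx_expD_gt0 M a b i j k : (forall i j, 0 <= M i j) ->
  0 < (M ^+ a) i j -> 0 < (M ^+ b) j k -> 0 < (M ^+ (a + b)) i k.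
Proof.
move=> M0 aij bjk; rewrite exprD mxE (bigD1 j) //= ltr_wpDr ?mulr_gt0 //.
by apply: sumr_ge0 => l _; rewrite mulr_ge0 ?mx_exp_ge0.
Qed.

Lemma irreducible_mx_connected M (S : 'I_n -> 'I_n -> Prop) :
  (forall i j, 0 <= M i j) -> irreducible_mx M ->
  (forall i j k, S i j -> S j k -> S i k) ->
  (forall i j, 0 < M i j -> S i j) -> forall i j, S i j.
Proof.
move=> M0 [k k0 Mirr] Strans SM.
have S_pow l i j : 0 < (M ^+ l.+1) i j -> S i j.
  elim: l i j => [|l IHl] i j; first by rewrite expr1; exact: SM.
  rewrite exprS mxE => /sum_gt0_exists[a /mulr_gt0_l[//|ia aj]].
  exact: Strans (SM _ _ ia) (IHl _ _ aj).
move=> i j; have := Mirr i j; rewrite summxE big_add1 /= => /sum_gt0_exists[l].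
exact: S_pow.
Qed.

End NonnegativeMatrices.

Section TurnMatrix.
Variables (R : realType) (m : nat) (A : 'M[R]_(m + m)) (q : 'rV[R]_(m + m)).
Hypothesis chain : reversible_chain A q.
Hypothesis turn_sq_connected : forall S : letter m -> letter m -> Prop,
  (forall i j k, S i j -> S j k -> S i k) ->
  (forall i j, 0 < turn_sq A i j -> S i j) -> forall i j, S i j.

Definition turn_mx : 'M[R]_(m + m) := \matrix_(i, j) A (linv i) j.

Lemma turn_mx_ge0 i j : 0 <= turn_mx i j.
Proof. by rewrite mxE; exact: (chain_ge0 chain). Qed.

Lemma turn_mx_sq i j : (turn_mx ^+ 2) i j = turn_sq A i j.
Proof. by rewrite expr2 mxE; apply: eq_bigr => k _; rewrite !mxE. Qed.

Lemma iter_turn_op (X : Type) k (f : letter m -> X -> R) i x :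
  iter k (turn_op A) f i x = \sum_j (turn_mx ^+ k) i j * f j x.
Proof.
elim: k i => [|k IHk] i.
  rewrite (bigD1 i) //= big1 ?addr0 => [|j ji]; first by rewrite mxE eqxx mul1r.
  by rewrite mxE eq_sym (negPf ji) mul0r.
rewrite iterS {1}/turn_op; under eq_bigr do rewrite IHk mulr_sumr.
rewrite exchange_big; apply: eq_bigr => j _ /=.
rewrite exprS mxE mulr_suml; apply: eq_bigr => l _.
by rewrite [turn_mx i l]mxE mulrA.
Qed.

(** From i go to some j in one step and return in an even number of steps, by
    the connectedness of the square. As the support is symmetric, there is also
    a return in two steps, which pads these odd lengths to a common one. *)
Lemma odd_power_diagonal : exists2 n, odd n & forall i, 0 < (turn_mx ^+ n) i i.
Proof.
have next i : exists j, 0 < turn_mx i j.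
  apply: (@sum_gt0_exists _ _ (index_enum _)).
  under eq_bigr do rewrite mxE; rewrite (chain_sum1 chain); exact: ltr01.
have diag2 i : 0 < (turn_mx ^+ 2) i i.
  have [j ij] := next i; rewrite (mx_expD_gt0 (a := 1) (b := 1) (j := j)) //.
  - exact: turn_mx_ge0.
  - rewrite expr1 mxE; have := turn_symmetric chain i j => /eqP.
    rewrite mxE in ij => /eqP H.
    have : 0 < q 0 j * A (linv j) i by rewrite -H mulr_gt0 ?(chain_law_gt0 chain).
    by rewrite pmulr_rgt0 ?(chain_law_gt0 chain).
have even_conn i j : exists r, 0 < (turn_mx ^+ r.*2) i j.
  apply: (turn_sq_connected (S := fun i j => exists r, 0 < (turn_mx ^+ r.*2) i j)).
    move=> {}i {}j k [a ija] [b jkb]; exists (a + b)%N; rewrite doubleD.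
    apply: mx_expD_gt0 ija jkb; exact: turn_mx_ge0.
  by move=> {}i {}j; rewrite -turn_mx_sq; exists 1%N.
have /choice[r Hr] : forall i, exists r, 0 < (turn_mx ^+ r.*2.+1) i i.
  move=> i; have [j ij] := next i; have [r jir] := even_conn j i; exists r.
  by rewrite -add1n; apply: mx_expD_gt0 jir => //; exact: turn_mx_ge0.
exists (\max_i r i).*2.+1 => [|i]; first by rewrite /= odd_double.
have ri : (r i <= \max_i r i)%N by exact: leq_bigmax.
rewrite -(subnK ri) addnC doubleD -addSn.
apply: mx_expD_gt0 (Hr i) _; first exact: turn_mx_ge0.
elim: (_ - _)%N => [|k IHk]; first by rewrite expr0 mxE eqxx ltr01.
rewrite doubleS -addn2; apply: mx_expD_gt0 IHk (diag2 i); exact: turn_mx_ge0.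
Qed.

Lemma odd_turns_return (X : Type) : exists n (eps : R), [/\ odd n, 0 < eps &
  forall f : letter m -> X -> R, (forall i y, 0 <= f i y) ->
  forall i y, eps * f i y <= iter n (turn_op A) f i y].
Proof.
have [n n_odd diag] := odd_power_diagonal.
have [eps eps0 eps_le] := finite_positive_bound diag.
exists n, eps; split => // f f0 i y.
rewrite iter_turn_op (bigD1 i) //= ler_wpDr ?ler_wpM2r //.
apply: sumr_ge0 => j _; rewrite mulr_ge0 // mx_exp_ge0 //; exact: turn_mx_ge0.
Qed.

End TurnMatrix.

(** * Spherical sums of the free group *)
Section Instance.
Variables (R : realType) (d : measure_display) (X : measurableType d).
Variables (nu : probability X R) (m : nat) (T : free_group m -> X -> X).
Variables (Pi : 'M[R]_(m + m)) (q : 'rV[R]_(m + m)).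
Hypothesis T_action : measure_preserving_action nu T.
Hypothesis Pi_stochastic : stochastic_mx Pi.
Hypothesis q_stationary : stationary_distribution Pi q.
Hypothesis q_gt0 : forall i, 0 < q 0 i.
Hypothesis Pi_irreducible : strictly_irreducible_mx Pi.
Hypothesis q_linv : forall i, q 0 i = q 0 (linv i).
Hypothesis Pi_linv : forall i j, Pi (linv i) (linv j) = q 0 j * Pi j i / q 0 i.

Definition letter_map i : X -> X := T (fg_letter i)^-1%g.
(** By the symmetry of Pi this is its time reversal: the weight of a word is read
    from its last letter, whereas its first letter acts first. *)
Definition inverse_chain : 'M[R]_(m + m) := \matrix_(i, j) Pi (linv i) (linv j).
Local Notation tau := letter_map.
Local Notation A := inverse_chain.

Lemma letter_map_action : letter_action nu tau.
Proof.
split=> [i x|i|i B mB].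
- rewrite /letter_map -(mpa_M T_action) -fg_letterV monoid.mulVg.
  exact: (mpa_1 T_action).
- exact: (mpa_measurable T_action).
- exact: (mpa_preserving T_action).
Qed.

Lemma inverse_chain_reversible : reversible_chain A q.
Proof.
split=> [i j|i|//|||i j].
- by rewrite mxE; case: Pi_stochastic.
- rewrite (reindex_inj (inv_inj (@linvK m))) /=.
  by under eq_bigr do rewrite mxE linvK; case: Pi_stochastic => _ ->.
- by case: q_stationary.
- by move=> i; rewrite -q_linv.
- rewrite !mxE !linvK Pi_linv; have := q_gt0 j.
  by move=> qj; rewrite mulrC [RHS]mulrC divfK ?gt_eqF.
Qed.

(** If Pi i k and Pi j k are positive, the letter i can turn into linv k and
    this one into j. *)
Lemma inverse_chain_connected (S : letter m -> letter m -> Prop) :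
  (forall i j k, S i j -> S j k -> S i k) ->
  (forall i j, 0 < turn_sq A i j -> S i j) -> forall i j, S i j.
Proof.
move=> Strans Sturn; have [Pi0 _] := Pi_stochastic; have [_ irr] := Pi_irreducible.
apply: (irreducible_mx_connected _ irr Strans) => [i j|i j].
  by rewrite mxE sumr_ge0 // => k _; rewrite mxE mulr_ge0.
rewrite mxE => /sum_gt0_exists[k]; rewrite mxE => /mulr_gt0_l[//|ik jk].
apply: Sturn; rewrite /turn_sq (bigD1 (linv k)) //= ltr_wpDr //.
  by apply: sumr_ge0 => l _; rewrite !mxE mulr_ge0.
rewrite !mxE !linvK mulr_gt0 // -[k]linvK Pi_linv linvK divr_gt0 // mulr_gt0 //.
Qed.

Lemma transition_weight_linv w :
  transition_weight A (map (@linv m) w) = transition_weight Pi w.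
Proof.
elim: w => [//|a w IHw] /=; case: w IHw => [//|b w] <-.
by rewrite /= mxE !linvK.
Qed.

(** Inverting the letters replaces Pi by A, and the law of A is invariant under
    inverting and reversing. *)
Lemma word_weight_rev w : word_weight A q (rev w) = word_weight Pi q w.
Proof.
have -> : rev w = reverse_word (map (@linv m) w) by rewrite /reverse_word mapK //; exact: linvK.
rewrite (word_weight_reverse inverse_chain_reversible).
case: w => [//|a w] /=; rewrite last_map -q_linv.
by congr (_ * _); exact: (transition_weight_linv (a :: w)).
Qed.

Lemma word_op_pos w (phi : X -> R) x : word_op T w phi x = phi (pos tau (rev w) x).
Proof.
elim: w x => [//|a w IHw] x; rewrite /= /koopman /= -/(word_op T w phi) IHw.
by rewrite rev_cons -cats1 pos_cat.
Qed.

Lemma spherical_sum_even_average k (phi : X -> R) :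
  spherical_sum T Pi q (2 * k.+1)%N phi = even_average tau A q phi k.
Proof.
apply/funext => x; rewrite mul2n doubleS /even_average /letter_avg.
pose f := markov_op tau A (fun=> phi).
transitivity (cond_exp A q k.*2.+2 (fun w => at_end tau f w x) [::]); last first.
  apply: eq_bigr => i _; congr (_ * _).
  exact: (cond_exp_at_end tau A q k.*2.+1 f i [::] x).
pose rv (w : k.*2.+2.-tuple (letter m)) : k.*2.+2.-tuple (letter m) := [tuple of rev w].
have rvK : involutive rv by move=> w; apply/val_inj; rewrite /= revK.
rewrite cond_exp_nil (reindex_inj (inv_inj rvK)); apply: eq_bigr => w _.
rewrite word_weight_rev word_op_pos /=; congr (_ * _).
have : size (rev w) = k.*2.+2 by rewrite size_rev size_tuple.
case: (rev w) => [//|i s] _ /=.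
by rewrite /f (markov_op_const _ inverse_chain_reversible).
Qed.

Lemma koopman_pos (phi : X -> R) (g : free_group m) x :
  koopman T g phi x = phi (pos tau (rev (fg_word g)) x).
Proof.
rewrite /koopman /=; congr phi; case: g => w rw /=.
elim: w rw x => [|a w IHw] rw x.
  have -> : FreeGroup rw = 1%g by exact: val_inj.
  by rewrite monoid.invg1 (mpa_1 T_action).
have rw' : reduced w by exact: path_sorted rw.
have -> : FreeGroup rw = (fg_letter a * FreeGroup rw')%g.
  apply: val_inj => /=; case: w rw {IHw rw'} => [//|b w] /= /andP[ba _].
  by rewrite (negPf ba).
rewrite monoid.invgM (mpa_M T_action) (IHw rw') rev_cons -cats1 pos_cat.
by [].
Qed.

Lemma ae_pos (Q : X -> Prop) w :
  {ae nu, forall x, Q x} -> {ae nu, forall x, Q (pos tau w x)}.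
Proof.
have action := letter_map_action.
elim: w Q => [//|i w IHw] Q Q_ae; apply: (IHw (fun x => Q (tau i x))).
apply: ae_comp Q_ae; first exact: (letter_action_measurable action).
exact: (letter_action_preserving action).
Qed.

(** A reduced word of even length is a product of pairs of letters. *)
Lemma even_invariant (psi : X -> R) :
  (forall i j, {ae nu, forall x, psi (tau i (tau j x)) = psi x}) ->
  forall g, g \in @even_fg m -> {ae nu, forall x, koopman T g psi x = psi x}.
Proof.
move=> inv g; rewrite inE => g_even.
have inv_pos k v : size v = k.*2 -> {ae nu, forall x, psi (pos tau v x) = psi x}.
  elim: k v => [|k IHk] [|i [|j v]] //=; first by move=> _; exact: aeW.
  rewrite doubleS => -[] /IHk IHv.
  by have := ae_pos v (inv i j); apply: filterS2 IHv => x <-.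
have := inv_pos (size (rev (fg_word g)))./2 (rev (fg_word g)) _.
rewrite size_rev even_halfK // => /(_ erefl); apply: filterS => x.
by rewrite koopman_pos.
Qed.

End Instance.

(** * The L^p norm *)
Section LpNorm.
Variables (R : realType) (d : measure_display) (X : measurableType d).
Variables (nu : probability X R) (p : R).
Hypothesis p_gt1 : 1 < p.
Let p_gt0 : 0 < p. Proof. exact: lt_trans p_gt1. Qed.
Implicit Types f : X -> R.

Lemma Lnorm_powint f : ('N[nu]_(p%:E)[EFin \o f] = powint nu p f `^ p^-1)%E.
Proof.
by rewrite unlock /powint; congr poweR; apply: eq_integral => x _; rewrite poweR_EFin.
Qed.

Lemma Lfun_powintP f :
  f \in Lfun nu p%:E <-> measurable_fun setT f /\ (powint nu p f < +oo)%E.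
Proof.
rewrite inE; split=> [/andP[/[!inE] mf fin]|[mf fin]].
  split=> //; have : (powint nu p f `^ p^-1 < +oo)%E by rewrite -Lnorm_powint.
  by apply: lty_poweRy; rewrite invr_neq0 // gt_eqF.
apply/andP; split; rewrite inE //= /finite_norm Lnorm_powint.
exact: poweR_lty.
Qed.

Lemma Lnorm_cvg0 (f : nat -> X -> R) : powint nu p (f k) @[k --> \oo] --> 0%E ->
  'N[nu]_(p%:E)[EFin \o f k]%E @[k --> \oo] --> 0%E.
Proof.
move=> /ereal_cvg0P f0; apply/ereal_cvg0P => [k|e e0]; first exact: Lnorm_ge0.
have ep : 0 < e `^ p by exact: powR_gt0.
apply: filterS (f0 (fun k => powint_ge0 _ _ _) _ ep) => k fk.
rewrite Lnorm_powint.
have -> : e%:E = ((e `^ p)%:E `^ p^-1)%E.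
  by rewrite poweR_EFin -powRrM mulfV ?gt_eqF // powRr1 // ltW.
apply: gt0_ler_poweR => //; rewrite ?in_itv /= ?leey ?andbT ?powint_ge0 //.
- by rewrite invr_ge0 ltW.
- by rewrite lee_fin ltW.
Qed.

End LpNorm.

Theorem theorem2 (R : realType) (d : measure_display) (X : measurableType d)
    (nu : probability X R) (m : nat) (T : free_group m -> X -> X)
    (p : R) (Pi : 'M[R]_(m + m)) (q : 'rV[R]_(m + m))
    (nu_lebesgue : lebesgue_probability_space nu)
    (T_action : measure_preserving_action nu T)
    (p_gt1 : 1 < p)
    (Pi_stochastic : stochastic_mx Pi)
    (q_stationary : stationary_distribution Pi q)
    (q_unique : forall q', stationary_distribution Pi q' -> q' = q)
    (q_gt0 : forall i, 0 < q 0 i)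
    (Pi_irreducible : strictly_irreducible_mx Pi)
    (q_linv : forall i, q 0 i = q 0 (linv i))
    (Pi_linv : forall i j, Pi (linv i) (linv j) = q 0 j * Pi j i / q 0 i)
    (phi : X -> R) (phi_Lp : phi \in Lfun nu p%:E) :
  exists psi : X -> R,
    [/\ psi \in Lfun nu p%:E,
        forall g, g \in @even_fg m ->
          {ae nu, forall x, koopman T g psi x = psi x},
        {ae nu, forall x, spherical_sum T Pi q (2 * n)%N phi x
          @[n --> \oo] --> psi x} &
        'N[nu]_(p%:E)[EFin \o (spherical_sum T Pi q (2 * n)%N phi \- psi)%R]%E
          @[n --> \oo] --> 0%E].
Proof.
have [mphi phi_fin] := (Lfun_powintP nu p_gt1 phi).1 phi_Lp.
have action := letter_map_action T_action.
have chain := inverse_chain_reversible Pi_stochastic q_stationary q_gt0 q_linv Pi_linv.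
have connected := inverse_chain_connected Pi_stochastic q_gt0 Pi_irreducible Pi_linv.
have [n [eps [n_odd eps_gt0 turn_eps]]] := odd_turns_return chain connected X.
have [psi [mpsi psi_fin psi_inv psi_ae psi_Lp]] :=
  even_average_converges action chain connected n_odd eps_gt0 turn_eps p_gt1 mphi phi_fin.
have sumE k : spherical_sum T Pi q (2 * k.+1)%N phi =
    even_average (letter_map T) (inverse_chain Pi) q phi k.
  by apply: spherical_sum_even_average.
exists psi; split.
- exact/(Lfun_powintP nu p_gt1).
- exact: even_invariant.
- apply: filterS psi_ae => x.
  rewrite -(cvg_shiftS (fun k => spherical_sum T Pi q (2 * k)%N phi x)) /=.
  by under [in X in _ -> X]eq_fun do rewrite sumE.
- have := Lnorm_cvg0 p_gt1 psi_Lp.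
  rewrite -(cvg_shiftS (fun k => 'N[nu]_(p%:E)[
    EFin \o (spherical_sum T Pi q (2 * k)%N phi \- psi)%R]%E)) /=.
  by under [in X in _ -> X]eq_fun do rewrite sumE.
Qed.
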